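(* Let $n\ge1$ be an integer, $1<p<1+\frac2n$, $\gamma>0$ and $\beta,\omega_1,\omega_2>0$. There exists a bijective correspondence between the sets $\mathcal{G}$ and $\mathcal{A}$.
   Context: Let $\mathbb{H}^1=H^1(\mathbb{R}^n,\mathbb{C})\times H^1(\mathbb{R}^n,\mathbb{C})$ (viewed as a real Hilbert space). For $U=(u_1,u_2)\in\mathbb{H}^1$ put $\|\nabla U\|_2^2=\|\nabla u_1\|_2^2+\|\nabla u_2\|_2^2$, $\|U\|_{2,\omega}^2=\omega_1\|u_1\|_2^2+\omega_2\|u_2\|_2^2$, $$F(U)=\tfrac{1}{2p}\left(\|u_1\|_{2p}^{2p}+\|u_2\|_{2p}^{2p}+2\beta\|u_1u_2\|_p^p\right),\quad \mathcal{E}(U)=\tfrac12\|\nabla U\|_2^2-F(U),\quad \mathcal{I}(U)=\mathcal{E}(U)+\tfrac12\|U\|_{2,\omega}^2.$$ Nehari manifold: $\mathcal{N}=\{W\in\mathbb{H}^1\setminus\{0\}:\langle\mathcal{I}'(W),W\rangle=0\}$, $m_{\mathcal{N}}=\inf_{\mathcal{N}}\mathcal{I}$. $\mathcal{G}$ is the set of ground state solutions, i.e. of all $U\in\mathcal{N}$ with $\mathcal{I}(U)=m_{\mathcal{N}}$. Let $\mathcal{M}_\gamma=\{U\in\mathbb{H}^1:\|U\|_{2,\omega}^2=\gamma\}$. $\mathcal{A}$ is the set of solutions of the minimization problem $\min_{\mathcal{M}_\gamma}\mathcal{E}$, i.e. of all $U\in\mathcal{M}_\gamma$ with $\mathcal{E}(U)=\inf_{\mathcal{M}_\gamma}\mathcal{E}$.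 *)

(* Defs.v *)
From HB Require Import structures.
From mathcomp Require Import all_boot all_order all_algebra.
From mathcomp Require Import all_classical all_reals all_analysis.
From mathcomp Require Import complex.

Set Implicit Arguments.
Unset Strict Implicit.
Unset Printing Implicit Defensive.
Import Order.TTheory GRing.Theory Num.Theory.
Import numFieldNormedType.Exports.

Local Open Scope classical_set_scope.
Local Open Scope ring_scope.
Local Open Scope complex_scope.

Section MeasurableRow.
Context {R : realType} (n : nat).

Let coord (i : 'I_n) (v : 'rV[R]_n) : measurableTypeR R := v ord0 i.

Let row_set0 : g_sigma_preimage coord set0.
Proof. exact: sigma_algebra0. Qed.

Let row_setC A : g_sigma_preimage coord A -> g_sigma_preimage coord (~` A).
Proof. exact: sigma_algebraC. Qed.

Let row_bigcup (F : _^nat) : (forall i, g_sigma_preimage coord (F i)) ->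
  g_sigma_preimage coord (\bigcup_i (F i)).
Proof. exact: sigma_algebra_bigcup. Qed.

(* The smallest sigma-algebra on R^n that makes the coordinates
   Borel-measurable, i.e. the Borel sigma-algebra of R^n. *)
HB.instance Definition _ := @isMeasurable.Build default_measure_display
  'rV[R]_n (g_sigma_preimage coord) row_set0 row_setC row_bigcup.

End MeasurableRow.

Section MeasurableComplex.
Context {R : realType}.

HB.instance Definition _ := isPointed.Build R[i] (0 : R[i]).

Let ReIm (z : R[i]) : (measurableTypeR R * measurableTypeR R)%type :=
  (complex.Re z, complex.Im z).

Let S := preimage_set_system setT ReIm measurable.

Let sigma_S : sigma_algebra setT S.
Proof. exact/sigma_algebra_preimage/sigma_algebra_measurable. Qed.

Let S0 : S set0.
Proof. by have [] := sigma_S. Qed.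

Let SC A : S A -> S (~` A).
Proof. by have [_ SD _] := sigma_S; move=> /SD; rewrite setTD. Qed.

Let S_bigcup (F : _^nat) : (forall i, S (F i)) -> S (\bigcup_i (F i)).
Proof. by have [_ _] := sigma_S; exact. Qed.

(* The Borel sigma-algebra of C = R x R. *)
HB.instance Definition _ := @isMeasurable.Build default_measure_display
  R[i] S S0 SC S_bigcup.

End MeasurableComplex.

Section LebesgueRow.
Context {R : realType}.

Section Step.
Variable n : nat.

Definition row_cons (z : measurableTypeR R * 'rV[R]_n) : 'rV[R]_n.+1 :=
  \row_i oapp (z.2 ord0) z.1 (unlift ord0 i).

Definition row_uncons (v : 'rV[R]_n.+1) : measurableTypeR R * 'rV[R]_n :=
  (v ord0 ord0, \row_i v ord0 (lift ord0 i)).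

Lemma row_uncons_cons : cancel row_uncons row_cons.
Proof.
move=> v; apply/rowP => i; rewrite !mxE /=.
by case: unliftP => [j ->|->] //=; rewrite mxE.
Qed.

Lemma row_cons_uncons : cancel row_cons row_uncons.
Proof.
case=> x v; rewrite /row_uncons mxE unlift_none; congr pair.
by apply/rowP => i; rewrite !mxE liftK.
Qed.

End Step.

Lemma measurable_coord n (i : 'I_n) :
  measurable_fun setT (fun v : 'rV[R]_n => v ord0 i : measurableTypeR R).
Proof.
move=> _ Y mY; rewrite setTI; apply: sub_sigma_algebra => /=.
rewrite -bigcup_seq/=; exists i => /=; first by rewrite mem_index_enum.
by exists Y => //; rewrite setTI.
Qed.

Lemma measurable_rowP d (T : measurableType d) n (f : T -> 'rV[R]_n) :
  (forall i, measurable_fun setT (fun x => f x ord0 i : measurableTypeR R)) ->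
  measurable_fun setT f.
Proof.
move=> mf.
suff H : preimage_set_system setT f measurable `<=` measurable.
  by move=> _ Y mY; apply: H; exists Y.
have <- := g_sigma_preimage_comp (fun i (v : 'rV[R]_n) => v ord0 i : measurableTypeR R) f.
apply: smallest_sub; first exact: sigma_algebra_measurable.
case: n f mf => [|n] f mf; first by rewrite big_ord0.
rewrite -bigcup_mkord_ord; apply: bigcup_sub => i Ii.
by move=> A [B mB <-]; exact: mf.
Qed.

Lemma measurable_row_cons n : measurable_fun setT (@row_cons n).
Proof.
apply: measurable_rowP => i; rewrite /row_cons.
case: (unliftP ord0 i) => [j ->|->].
- under eq_fun do rewrite mxE liftK /=.
  exact: (measurableT_comp (@measurable_coord n j) measurable_snd).
- under eq_fun do rewrite mxE unlift_none /=.
  exact: measurable_fst.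
Qed.

Lemma measurable_row_uncons n : measurable_fun setT (@row_uncons n).
Proof.
apply/measurable_fun_pairP; split; first exact: measurable_coord.
apply: measurable_rowP => i /=.
under eq_fun do rewrite mxE.
exact: measurable_coord.
Qed.

Section LebesgueStep.
Variables (n : nat) (m : {sigma_finite_measure set 'rV[R]_n -> \bar R}).

Definition lebesgue_row_step : set 'rV[R]_n.+1 -> \bar R :=
  pushforward (@lebesgue_measure R \x m)%E (@row_cons n).

Let step_measure : {measure set 'rV[R]_n.+1 -> \bar R} :=
  measure_function_pushforward__canonical__measure_function_Measure
    (@lebesgue_measure R \x m)%E (@measurable_row_cons n).

Let step0 : lebesgue_row_step set0 = 0%E.
Proof. exact: (measure0 step_measure). Qed.

Let step_ge0 A : (0 <= lebesgue_row_step A)%E.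
Proof. exact: (measure_ge0 step_measure). Qed.

Let step_sigma_additive : semi_sigma_additive lebesgue_row_step.
Proof. exact: (@measure_semi_sigma_additive _ _ _ step_measure). Qed.

HB.instance Definition _ := isMeasure.Build _ _ _ lebesgue_row_step
  step0 step_ge0 step_sigma_additive.

Let step_sigma_finite : sigma_finite setT lebesgue_row_step.
Proof.
have /sigma_finiteP[F [TF ndF Foo]] := sigma_finiteT (@lebesgue_measure R).
have /sigma_finiteP[G [TG ndG Goo]] := sigma_finiteT m.
exists (fun k => @row_uncons n @^-1` (F k `*` G k)).
  rewrite -preimage_bigcup (_ : \bigcup_k _ = setT) ?preimage_setT//.
  rewrite -subTset => -[x y] _ /=.
  have [k _ Fkx] : (\bigcup_k F k) x by rewrite -TF.
  have [l _ Gly] : (\bigcup_k G k) y by rewrite -TG.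
  exists (maxn k l) => //; split => /=.
  - by move: x Fkx; exact/subsetPset/ndF/leq_maxl.
  - by move: y Gly; exact/subsetPset/ndG/leq_maxr.
move=> k; have [mF Fk] := Foo k; have [mG Gk] := Goo k; split.
  rewrite -[X in measurable X]setTI; apply: measurable_row_uncons => //.
  exact: measurableX.
rewrite /lebesgue_row_step /pushforward -comp_preimage.
rewrite (_ : _ \o _ = id); last first.
  by apply/funext => z /=; rewrite row_cons_uncons.
rewrite preimage_id product_measure1E// lte_mul_pinfty// ge0_fin_numE//.
Qed.

HB.instance Definition _ := Measure_isSigmaFinite.Build _ _ _
  lebesgue_row_step step_sigma_finite.

End LebesgueStep.

(* Lebesgue measure on R^n, as an iterated product. *)
Fixpoint lebesgue_row (n : nat) : {sigma_finite_measure set 'rV[R]_n -> \bar R} :=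
  match n with
  | 0 => @dirac _ _ (0 : 'rV[R]_0) R
  | n'.+1 => @lebesgue_row_step n' (lebesgue_row n')
  end.

Lemma lebesgue_row_box n (A : 'I_n -> set (measurableTypeR R)) :
  (forall i, measurable (A i)) ->
  lebesgue_row n [set v | forall i, A i (v ord0 i)] =
  (\prod_(i < n) lebesgue_measure (A i))%E.
Proof.
elim: n A => [|n IH] A mA.
  by rewrite big_ord0 /= diracE mem_set// => -[].
rewrite big_ord_recl /= /lebesgue_row_step /pushforward.
have mbox : measurable [set v : 'rV[R]_n | forall i, A (lift ord0 i) (v ord0 i)].
  have -> : [set v : 'rV[R]_n | forall i, A (lift ord0 i) (v ord0 i)] =
      \bigcap_(i in [set: 'I_n]) (fun v : 'rV[R]_n => v ord0 i) @^-1` A (lift ord0 i).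
    by apply/seteqP; split => v /= H i; [move=> _; exact: H|exact: H].
  apply: fin_bigcap_measurable => // i _.
  by rewrite -[X in measurable X]setTI; exact: measurable_coord.
have -> : @row_cons n @^-1` [set v | forall i, A i (v ord0 i)] = A ord0 `*`
    [set v : 'rV[R]_n | forall i, A (lift ord0 i) (v ord0 i)].
  apply/seteqP; split => -[x v] /=.
  - move=> H; split=> [|i].
      by have := H ord0; rewrite mxE unlift_none.
    by have := H (lift ord0 i); rewrite mxE liftK.
  - by case=> Hx Hv i; rewrite mxE; case: unliftP => [j ->|->] /=.
by rewrite product_measure1E// (IH (fun i => A (lift ord0 i))).
Qed.

End LebesgueRow.

Section Sobolev.
Context {R : realType} {n : nat}.
Local Notation Rn := 'rV[R]_n.
Local Notation mu := (lebesgue_row n).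
Implicit Types u v : Rn -> R[i].

Definition partial (k : 'I_n) (phi : Rn -> R) : Rn -> R :=
  fun x => 'D_(delta_mx ord0 k) phi x.

(* Real-valued C^oo functions with compact support: every iterated partial
   derivative exists and is continuous. *)
Definition test_function (phi : Rn -> R) : Prop :=
  (forall s : seq 'I_n, continuous (foldr partial phi s) /\
     forall k x, derivable (foldr partial phi s) x (delta_mx ord0 k)) /\
  compact (closure [set x | phi x != 0]).

Definition L2 u : Prop :=
  measurable_fun setT u /\
  (\int[mu]_x (Normc.normc (u x) ^+ 2)%:E < +oo)%E.

(* The identity \int u (d_k phi) = - \int v phi between complex numbers is
   stated on real and imaginary parts, phi being real-valued. *)
Definition is_weak_partial (k : 'I_n) u v : Prop :=
  forall phi, test_function phi ->
    (\int[mu]_x (complex.Re (u x) * partial k phi x)%R =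
       - (\int[mu]_x (complex.Re (v x) * phi x)%R)) /\
    (\int[mu]_x (complex.Im (u x) * partial k phi x)%R =
       - (\int[mu]_x (complex.Im (v x) * phi x)%R)).

Definition is_weak_gradient u (g : 'I_n -> Rn -> R[i]) : Prop :=
  forall k, L2 (g k) /\ is_weak_partial k u (g k).

Definition in_H1 u : Prop := L2 u /\ exists g, is_weak_gradient u g.

(* A representative of the weak gradient, which is unique up to a.e. equality. *)
Definition weak_gradient u : 'I_n -> Rn -> R[i] :=
  xget (fun=> cst 0) [set g | is_weak_gradient u g].

(* ||u||_q^q *)
Definition Lpow (q : R) u : R := \int[mu]_x (Normc.normc (u x) `^ q).

(* ||grad u||_2^2 *)
Definition dirichlet u : R := \sum_(k < n) Lpow 2 (weak_gradient u k).

End Sobolev.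

Section System.
Context {R : realType} {n : nat}.
Variables (p beta w1 w2 : R).
Local Notation Rn := 'rV[R]_n.
Local Notation mu := (lebesgue_row n).

Definition vfun : Type := ((Rn -> R[i]) * (Rn -> R[i]))%type.
Implicit Types U V : vfun.

Definition vdirichlet U : R := dirichlet U.1 + dirichlet U.2.

(* ||U||_{2,omega}^2 *)
Definition vmass U : R := w1 * Lpow 2 U.1 + w2 * Lpow 2 U.2.

Definition potential U : R :=
  (2 * p)^-1 * (Lpow (2 * p) U.1 + Lpow (2 * p) U.2
                + 2 * beta * Lpow p (fun x => U.1 x * U.2 x)).

Definition energy U : R := 2^-1 * vdirichlet U - potential U.

Definition action U : R := energy U + 2^-1 * vmass U.

Definition vline U V (t : R) : vfun :=
  (fun x => U.1 x + t%:C * V.1 x, fun x => U.2 x + t%:C * V.2 x).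

(* <I'(U), V> *)
Definition daction U V : R := derive1 (fun t : R => action (vline U V t)) 0.

(* Pairs of measurable functions R^n -> C modulo equality a.e. *)
Definition vclass : Type :=
  ({mfun_ mu, Rn >-> R[i]} * {mfun_ mu, Rn >-> R[i]})%type.

Definition vrepr (W : vclass) : vfun := (W.1 : Rn -> R[i], W.2 : Rn -> R[i]).

Definition vclass0 : vclass :=
  let z := (\pi_({mfun_ mu, Rn >-> R[i]}) (cst (0 : R[i])))%qT in (z, z).

Definition HH1 : set vclass :=
  [set W | in_H1 (vrepr W).1 /\ in_H1 (vrepr W).2].

Definition nehari : set vclass :=
  [set W | [/\ HH1 W, W <> vclass0 & daction (vrepr W) (vrepr W) = 0]].

Definition m_nehari : \bar R :=
  ereal_inf [set (action (vrepr W))%:E | W in nehari].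

Definition ground_states : set vclass :=
  [set W | nehari W /\ (action (vrepr W))%:E = m_nehari].

Definition mass_sphere (gamma : R) : set vclass :=
  [set W | HH1 W /\ vmass (vrepr W) = gamma].

Definition energy_minimizers (gamma : R) : set vclass :=
  [set W | mass_sphere gamma W /\
     (energy (vrepr W))%:E =
       ereal_inf [set (energy (vrepr V))%:E | V in mass_sphere gamma]].

End System.

Arguments ground_states {R} n p beta w1 w2.
Arguments energy_minimizers {R} n p beta w1 w2 gamma.

(* Main.v *)
Require Import Defs.
From HB Require Import structures.
From mathcomp Require Import all_boot all_order all_algebra.
From mathcomp Require Import all_classical all_reals all_analysis.
From mathcomp Require Import complex.
From mathcomp Require Import measurable_realfun.
From mathcomp Require Import ring lra.

(* Only scaling is needed, no Gagliardo-Nirenberg or compactness argument.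
   Write D, M, F for the Dirichlet, mass and potential terms, and put
   a = n(p-1)/2, which lies in (0,1), and b = p - a.  Under W -> m W(l .) they
   are multiplied by m^2 l^(2-n), m^2 l^(-n) and m^(2p) l^(-n), so that the
   quotient D^a M^b / F is invariant.  Moving along the dilations, a ground
   state is exactly a minimizer of the quotient with D = 2aF and M = 2bF, and a
   minimizer of the energy on the mass sphere is exactly a minimizer of the
   quotient with D = 2aF and M = gamma; the two comparisons are strict cases of
   weighted AM-GM, i.e. of ln x <= x - 1 and of Bernoulli's inequality.  The
   one-parameter group l = m^(p-1) preserves D = 2aF and connects the two
   normalizations of M, which gives the bijection.

   The analytic input is the behaviour of the weak gradient under dilations.
   Since the gradient is a chosen representative, this rests on its a.e.
   uniqueness, hence on the fundamental lemma of the calculus of variations,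
   obtained from products of one-dimensional bump functions.  The same bump
   functions provide an element of H^1 with F > 0; it is needed because the
   integrals defining F take the value 0 when they diverge. *)

Set Implicit Arguments.
Unset Strict Implicit.
Unset Printing Implicit Defensive.
Import Order.TTheory GRing.Theory Num.Theory.
Import numFieldNormedType.Exports.

Local Open Scope classical_set_scope.
Local Open Scope ring_scope.

(** * Borel structure and dilations of R^n *)

Lemma measurable_ball_row (R : realType) n (x : 'rV[R]_n) (e : R) :
  0 < e -> measurable (ball x e).
Proof.
move=> e0.
have -> : ball x e = \bigcap_(j in [set: 'I_n])
    (fun v : 'rV[R]_n => v ord0 j : measurableTypeR R) @^-1` ball (x ord0 j) e.
  apply/seteqP; split => y.
    by case=> _ H j _ /=; exact: H.
  by move=> H; split=> // i j; rewrite ord1; exact: H.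
apply: fin_bigcap_measurable => // j _.
rewrite -[X in measurable X]setTI; apply: measurable_coord => //.
exact: measurable_ball.
Qed.

(** Measurability on ['rV[R]_n] is generated by the coordinates, so open sets need an argument: each
    is a countable union of sup-norm balls with rational centres and radii [k.+1%:R^-1]. *)
Lemma open_measurable_row (R : realType) n (O : set 'rV[R]_n) :
  open O -> measurable O.
Proof.
move=> oO.
pose c (q : 'rV[rat]_n) : 'rV[R]_n := map_mx ratr q.
pose B (q : 'rV[rat]_n) := \bigcup_(k : nat)
  (if `[< ball (c q) k.+1%:R^-1 `<=` O >] then ball (c q) k.+1%:R^-1 else set0).
have -> : O = \bigcup_q B q.
  apply/seteqP; split => [x Ox|x [q _ [k _]]]; last first.
    by case: asboolP => // + xb; exact.
  have /nbhs_ballP [e /= e0 eO] : nbhs x O by exact: open_nbhs_nbhs.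
  (* A radius below [e / 2] keeps any ball of that radius containing [x] inside [ball x e]. *)
  have [k ke] : exists k : nat, k.+1%:R^-1 < e / 2.
    have e20 : 0 < e / 2 by rewrite divr_gt0.
    by have [k] := ltr_add_invr e20; rewrite add0r; exists k.
  have k0 : 0 < k.+1%:R^-1 :> R by rewrite invr_gt0.
  have qE (j : 'I_n) : exists q : rat, ball (x ord0 j) k.+1%:R^-1 (ratr q).
    have /rat_in_itvoo[q] : x ord0 j - k.+1%:R^-1 < x ord0 j + k.+1%:R^-1.
      by rewrite ltrBlDr -addrA ltrDl addr_gt0.
    rewrite in_itv/= => /andP[q1 q2]; exists q.
    by rewrite /ball/= ltr_norml; move: q1 q2; set d := _^-1 => ? ?; apply/andP; split; lra.
  pose q := \row_j sval (cid (qE j)).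
  have bq : ball (c q) k.+1%:R^-1 x.
    split=> // i j; rewrite ord1 !mxE; apply: ball_sym.
    exact: (svalP (cid (qE j))).
  exists q => //; exists k => //.
  case: asboolP => // -[]; apply: subset_trans eO => y by_.
  apply: (le_ball (ltW _)); last exact: ball_triangle (ball_sym bq) by_.
  by move: ke; set d := _^-1 => ?; lra.
apply: countable_bigcupT_measurable => [|q].
  exact: countableP.
apply: bigcupT_measurable => k; case: ifP => // _.
by apply: measurable_ball_row; rewrite invr_gt0.
Qed.

Lemma continuous_measurable_row (R : realType) n (f : 'rV[R]_n -> R) :
  continuous f -> measurable_fun setT (f : _ -> measurableTypeR R).
Proof.
move=> cf; apply: (measurability _ (RGenOpens.measurableE R)) => _ [_ [a [b ->]] <-].
rewrite setTI; apply: open_measurable_row.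
by apply: open_comp => // ? _; exact: cf.
Qed.

(** * Lebesgue measure and nonnegative integrals under dilations *)

Section LebesgueScaling.
Context {R : realType}.

(** By uniqueness of Lebesgue measure: the right-hand side is a measure in [A], and it gives
    half-open intervals their length. *)
Lemma lebesgue_measure_dilate (l : R) (l0 : 0 < l)
    (A : set (measurableTypeR R)) : measurable A ->
  lebesgue_measure A = (l%:E * pushforward (@lebesgue_measure R)
    (fun x : measurableTypeR R => (l * x)%R : measurableTypeR R) A)%E.
Proof.
have ml : measurable_fun setT
    (fun x : measurableTypeR R => l * x : measurableTypeR R).
  exact: measurable_funM.
pose m := mscale (NngNum (ltW l0))
  (measure_function_pushforward__canonical__measure_function_Measure
    (@lebesgue_measure R) ml).
move=> mA; apply: (@lebesgue_measure_unique R m) => // _ [[a b]] _ <-.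
rewrite -[RHS]/(l%:E * lebesgue_measure ( *%R l @^-1` `]a, b]))%E.
rewrite (_ : _ @^-1` _ = `]a / l, b / l]%classic); last first.
  apply/seteqP; split => x; rewrite /= !in_itv/= ltr_pdivrMr// ler_pdivlMr//;
    by rewrite (mulrC x).
rewrite !lebesgue_measure_itv/= !lte_fin ltr_pM2r ?invr_gt0//.
case: ifP => _; last by rewrite mule0.
by rewrite -!EFinB -EFinM -mulrBl mulrC divfK ?gt_eqF.
Qed.

Lemma ge0_integral_dilate1 (l : R) (f : R -> \bar R) : 0 < l ->
  measurable_fun setT (f : measurableTypeR R -> _) -> (forall x, (0 <= f x)%E) ->
  (\int[lebesgue_measure]_x f x = l%:E * \int[lebesgue_measure]_x f (l * x)%R)%E.
Proof.
move=> l0 mf f0.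
have ml : measurable_fun setT
    (fun x : measurableTypeR R => l * x : measurableTypeR R).
  exact: measurable_funM.
pose m := mscale (NngNum (ltW l0))
  (measure_function_pushforward__canonical__measure_function_Measure
    (@lebesgue_measure R) ml).
rewrite (@eq_measure_integral _ _ _ _ m); last first.
  by move=> A mA _; exact: lebesgue_measure_dilate.
rewrite ge0_integral_mscale//=; congr (_ * _)%E.
by rewrite ge0_integral_pushforward// preimage_setT.
Qed.

Lemma ge0_integral_row_cons n (f : 'rV[R]_n.+1 -> \bar R) :
  measurable_fun setT f -> (forall x, (0 <= f x)%E) ->
  (\int[lebesgue_row n.+1]_x f x =
   \int[lebesgue_measure]_x \int[lebesgue_row n]_v f (row_cons (x, v)))%E.
Proof.
move=> mf f0.
rewrite [LHS](@ge0_integral_pushforward _ _ _ _ _ (@row_cons R n)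
  (@measurable_row_cons R n))//.
rewrite preimage_setT fubini_tonelli1//.
  by apply: measurableT_comp => //; exact: measurable_row_cons.
by move=> x /=.
Qed.

Lemma row_consZ n (l x : R) (v : 'rV[R]_n) :
  l *: row_cons (x, v) = row_cons (l * x, l *: v).
Proof.
by apply/rowP => i; rewrite !mxE; case: unliftP => [j _|_] //=; rewrite mxE.
Qed.

Lemma measurable_scale_row n (l : R) :
  measurable_fun setT (fun x : 'rV[R]_n => l *: x).
Proof.
apply: measurable_rowP => i; under eq_fun do rewrite mxE.
by apply: measurable_funM => //; exact: measurable_coord.
Qed.

(** Induction on the dimension by Tonelli: the first coordinate contributes one factor [l^-1], the
    induction hypothesis the remaining [l ^- n]. *)
Lemma ge0_integral_dilate n (l : R) (f : 'rV[R]_n -> \bar R) : 0 < l ->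
  measurable_fun setT f -> (forall x, (0 <= f x)%E) ->
  (\int[lebesgue_row n]_x f (l *: x)%R =
   (l ^- n)%:E * \int[lebesgue_row n]_x f x)%E.
Proof.
move=> l0; elim: n f => [|n IH] f mf f0.
  rewrite expr0 invr1 mul1e; apply: eq_integral => x _.
  by rewrite (_ : l *: x = x)//; apply/rowP => -[].
have mfl : measurable_fun setT (fun x : 'rV[R]_n.+1 => f (l *: x)).
  by apply: measurableT_comp => //; exact: measurable_scale_row.
rewrite !ge0_integral_row_cons//.
have mcons : measurable_fun setT (f \o @row_cons R n).
  by apply: measurableT_comp => //; exact: measurable_row_cons.
rewrite (eq_integral (fun x : measurableTypeR R => (l ^- n)%:E *
    \int[lebesgue_row n]_v f (row_cons ((l * x)%R, v)))%E); last first.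
  move=> x _; rewrite -(IH (fun v => f (row_cons (l * x, v))))//.
    by apply: eq_integral => v _; rewrite row_consZ.
  exact: (measurableT_comp mcons (@measurable_pair1 _ _ _ _ (l * x))).
have ml : measurable_fun setT
    (fun x : measurableTypeR R => l * x : measurableTypeR R).
  exact: measurable_funM.
pose g x := (\int[lebesgue_row n]_v f (row_cons (x, v)))%E.
have mg : measurable_fun setT (g : measurableTypeR R -> _).
  exact: (@measurable_fun_fubini_tonelli_F _ _ _ _ _ (lebesgue_row n) _ mcons (fun z => f0 _)).
have g0 x : (0 <= g x)%E by exact: integral_ge0.
rewrite ge0_integralZl//; last 2 first.
- by move=> x _; exact: g0.
- by rewrite lee_fin invr_ge0 exprn_ge0// ltW.
rewrite [in RHS](ge0_integral_dilate1 l0 mg g0) muleA -EFinM exprSr invfM.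
  by rewrite mulfVK ?gt_eqF.
exact: (measurableT_comp mg ml).
Qed.

End LebesgueScaling.

(** * Smooth bump functions *)

Section Smooth1.
Context {R : realType}.
Implicit Types (f g : R -> R) (m : nat).

(** The derivative is an existential witness, so closure properties follow by exhibiting one and
    recursing on it. *)
Fixpoint Ck m f : Prop :=
  match m with
  | 0 => continuous f
  | m'.+1 => exists2 df, (forall x : R, is_derive x 1 f (df x)) & Ck m' df
  end.

Definition smooth f := forall m, Ck m f.

Lemma Ck_continuous m f : Ck m f -> continuous f.
Proof.
case: m => // m [df fdf _] x.
by apply: differentiable_continuous; apply/derivable1_diffP; have [] := fdf x.
Qed.

Lemma CkW m f : Ck m.+1 f -> Ck m f.
Proof.
elim: m f => [|m IH] f; first exact: Ck_continuous.
by case=> df fdf /IH dfm; exists df.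
Qed.

Lemma CkD m f g : Ck m f -> Ck m g -> Ck m (fun x => f x + g x).
Proof.
elim: m f g => [|m IH] f g; first by move=> cf cg x; apply: cvgD; [exact: cf|exact: cg].
case=> df fdf dfm [dg gdg dgm]; exists (fun x => df x + dg x); last exact: IH.
by move=> x; exact: is_deriveD.
Qed.

Lemma CkM m f g : Ck m f -> Ck m g -> Ck m (fun x => f x * g x).
Proof.
elim: m f g => [|m IH] f g; first by move=> cf cg x; apply: cvgM; [exact: cf|exact: cg].
(* The product rule brings back [f] and [g] themselves, now at order [m]. *)
move=> fm gm; have fm' := CkW fm; have gm' := CkW gm.
case: fm => df fdf dfm; case: gm => dg gdg dgm.
exists (fun x => f x * dg x + g x * df x).
  by move=> x; exact: is_deriveM.
by apply: CkD; exact: IH.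
Qed.

Lemma Ck_cst m (c : R) : Ck m (fun=> c).
Proof.
elim: m c => [|m IH] c; first exact: cst_continuous.
by exists (fun=> 0) => // x; exact: is_derive_cst.
Qed.

Lemma is_derive_affine (a b x : R) : is_derive x 1 (fun x => a * x + b) a.
Proof.
have := is_deriveD (is_deriveZ a (is_derive_id x (1 : R))) (is_derive_cst b x (1 : R)).
by rewrite addr0 scaler1; exact.
Qed.

Lemma Ck_affine m f (a b : R) : Ck m f -> Ck m (fun x => f (a * x + b)).
Proof.
have aff x := is_derive_affine a b x.
elim: m f => [|m IH] f.
  move=> cf x; apply: (@continuous_comp _ _ _ (fun x => a * x + b) f).
    apply: differentiable_continuous; apply/derivable1_diffP.
    by have [] := aff x.
  exact: cf.
case=> df fdf dfm; exists (fun x => df (a * x + b) * a).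
  move=> x; exact: (@is_derive1_comp _ f (fun x => a * x + b)).
by apply: CkM; [exact: IH|exact: Ck_cst].
Qed.

Lemma smoothM f g : smooth f -> smooth g -> smooth (fun x => f x * g x).
Proof. by move=> fs gs m; exact: CkM. Qed.

Lemma smooth_affine f (a b : R) : smooth f -> smooth (fun x => f (a * x + b)).
Proof. by move=> fs m; exact: Ck_affine. Qed.

(** The witnesses hidden in [Ck m.+1 f] for different [m] all coincide with [derive1 f], by
    uniqueness of derivatives. *)
Lemma smooth_derive f : smooth f ->
  (forall x : R, is_derive x 1 f (derive1 f x)) /\ smooth (derive1 f).
Proof.
move=> sf; have fE m : exists2 df, derive1 f = df &
    (forall x : R, is_derive x 1 f (df x)) /\ Ck m df.
  have [df fdf dfm] := sf m.+1; exists df; last by [].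
  by apply/funext => x; rewrite derive1E derive_val.
split; first by have [df -> []] := fE 0.
by move=> m; have [df -> []] := fE m.
Qed.

(* P(1/x) exp(-1/x) extended by 0; the derivative stays in this family. *)
Definition flat (P : {poly R}) (x : R) : R :=
  if 0 < x then P.[x^-1] * expR (- x^-1) else 0.

Lemma horner_le_expR (P : {poly R}) : exists2 C : R, 0 <= C &
  forall y, 0 <= y -> `|P.[y]| <= C * expR y.
Proof.
exists (\sum_(i < size P) `|P`_i| * i`!%:R).
  by apply: sumr_ge0 => i _; rewrite mulr_ge0.
move=> y y0; rewrite horner_coef mulr_suml.
apply: le_trans (ler_norm_sum _ _ _) _; apply: ler_sum => i _.
rewrite normrM normrX (ger0_norm y0) -mulrA ler_wpM2l//.
case: (nat_of_ord i) => [|k].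
  by rewrite expr0 fact0 mul1r -expR0 ler_expR.
rewrite -ler_pdivrMl ?ltr0n ?fact_gt0// mulrC.
by apply: le_trans (expR_ge1Dxn k y0); rewrite lerDr.
Qed.

(** This quadratic bound yields the derivative 0 at the origin. Applying the exponential bound to
    [P * 'X^2] at [x^-1] buys the factor [x ^+ 2]. *)
Lemma flat_le_sqr (P : {poly R}) : exists2 C : R, 0 <= C &
  forall x, `|flat P x| <= C * x ^+ 2.
Proof.
have [C C0 PC] := horner_le_expR (P * 'X^2); exists C => // x.
rewrite /flat; case: ifPn => [x0|_]; last first.
  by rewrite normr0 mulr_ge0 ?sqr_ge0.
have := PC x^-1 ltac:(by rewrite invr_ge0 ltW).
rewrite hornerM hornerXn normrM normrX (@ger0_norm _ x^-1) ?invr_ge0 ?(ltW x0)// => H.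
rewrite normrM (@ger0_norm _ (expR _)) ?expR_ge0//.
rewrite expRN ler_pdivrMr ?expR_gt0// mulrAC -ler_pdivrMr ?exprn_gt0//.
by rewrite -exprVn.
Qed.

(** For [x > 0], differentiating [P.[x^-1]] and [expR (- x^-1)] produces [x ^- 2] times
    [- P^]()[and]P[respectively, evaluated at]x^-1[; this is the polynomial]'X^2 * (P - P^[())]. For
    [x < 0] the function is locally 0, and at 0 the quadratic bound applies. *)
Lemma is_derive_flat (P : {poly R}) (x : R) :
  is_derive x 1 (flat P) (flat ('X^2 * (P - P^`())) x).
Proof.
have [x0|x0|->] := ltgtP x 0.
- have nf : {near x, cst 0 =1 flat P}.
    near=> y; rewrite /flat ifF//; apply/negbTE; rewrite -leNgt ltW//.
    by near: y; exact: lt_nbhsl.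
  rewrite {2}/flat ltNge (ltW x0)/=; apply: DeriveDef.
    exact: (near_eq_derivable nf).
  by rewrite -(near_eq_derive _ nf) derive_cst.
- have nf : {near x, (fun y => P.[y^-1] * expR (- y^-1)) =1 flat P}.
    by near=> y; rewrite /flat ifT//; near: y; exact: lt_nbhsr.
  have dV : is_derive x (1 : R) (fun y : R => y^-1) (- x ^- 2).
    have := @is_deriveV _ id x 1 1 (lt0r_neq0 x0) _.
    by rewrite scaler1; exact.
  have dP : is_derive x (1 : R) (fun y : R => P.[y^-1]) (P^`().[x^-1] * - x ^- 2).
    exact: (@is_derive1_comp _ (horner P) (fun y : R => y^-1)).
  have dE : is_derive x (1 : R) (fun y : R => expR (- y^-1)) (expR (- x^-1) * x ^- 2).
    apply: (@is_derive1_comp _ expR (fun y : R => - y^-1)).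
    by apply: is_derive_eq; rewrite opprK.
  have d := is_deriveM dP dE.
  rewrite /flat x0; apply: DeriveDef.
    by apply: (near_eq_derivable nf); have [] := d.
  rewrite -(near_eq_derive _ nf) derive_val !hornerE exprVn.
  by rewrite /GRing.scale/=; ring.
- rewrite {2}/flat ltxx.
  have [C C0 PC] := flat_le_sqr P.
  have f0 : flat P 0 = 0 by rewrite /flat ltxx.
  have c : (fun h => h^-1 *: (flat P (h *: (1 : R) + 0) - flat P 0)) @ 0^' --> (0 : R).
    apply/cvgr0Pnorm_lt => e e0.
    (* [C] may be 0 and a division by the constant follows. *)
    have C10 : 0 < C + 1 by rewrite ltr_wpDl.
    near=> h.
    have h0 : h != 0 by near: h; exact: nbhs_dnbhs_neq.
    rewrite f0 subr0 addr0 scaler1 normrZ normfV.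
    rewrite -ltr_pdivlMl ?invr_gt0 ?normr_gt0// invrK.
    apply: le_lt_trans (PC h) _; apply: (@le_lt_trans _ _ ((C + 1) * h ^+ 2)).
      by rewrite ler_wpM2r ?sqr_ge0// lerDl.
    rewrite -real_normK ?num_real// expr2 mulrA mulrC ltr_pM2l ?normr_gt0//.
    by rewrite mulrC -ltr_pdivlMr//; near: h; apply: dnbhs0_lt; rewrite divr_gt0.
  apply: DeriveDef; first by apply/cvg_ex; exists 0.
  exact: cvg_lim.
Unshelve. all: by end_near. Qed.

Lemma smooth_flat (P : {poly R}) : smooth (flat P).
Proof.
move=> m; elim: m P => [|m IH] P.
  move=> x; apply: differentiable_continuous; apply/derivable1_diffP.
  by have [] := is_derive_flat P x.
by exists (flat ('X^2 * (P - P^`()))) => // x; exact: is_derive_flat.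
Qed.

End Smooth1.

(** * Products of one-dimensional smooth functions as test functions *)

Section Tensor.
Context {R : realType} {n : nat}.
Implicit Types (psi : 'I_n -> R -> R) (x : 'rV[R]_n).

Definition tensor psi x : R := \prod_i psi i (x ord0 i).

Definition box (K : R) : set 'rV[R]_n := [set x | forall i, `[- K, K]%classic (x ord0 i)].

(** A directional derivative depends only on the restriction to a line, so it can be transferred
    between spaces, in particular to functions of one real variable. *)
Lemma is_derive_line (V W : normedModType R) (f : V -> R) (g : W -> R)
    (x v : V) (y w : W) (l : R) :
  (forall h : R, f (h *: v + x) = g (h *: w + y)) ->
  is_derive y w g l -> is_derive x v f l.
Proof.
move=> fg [dg dgl].
have E : (fun h : R => h^-1 *: ((f \o shift x) (h *: v) - f x)) =
         (fun h : R => h^-1 *: ((g \o shift y) (h *: w) - g y)).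
  apply/funext => h /=; rewrite fg; congr (_ *: (_ - _)).
  by have := fg 0; rewrite !scale0r !add0r.
by split; [rewrite /derivable E|rewrite /derive E].
Qed.

Lemma is_derive_tensor psi x (k : 'I_n) (l : R) :
  is_derive (x ord0 k) 1 (psi k) l ->
  is_derive x (delta_mx ord0 k) (tensor psi)
    (l * \prod_(i | i != k) psi i (x ord0 i)).
Proof.
set c := \prod_(i | _) _.
move=> dk; apply: (@is_derive_line _ _ _ (fun t => psi k t * c) _ _ (x ord0 k) 1).
  move=> h; rewrite /tensor (bigD1 k)//= !mxE !eqxx mulr1 [h *: 1]mulr1.
  congr (_ * _); apply: eq_bigr => i ik.
  by rewrite !mxE (negPf ik) andbF mulr0 add0r.
have := is_deriveM dk (is_derive_cst c (x ord0 k) (1 : R)).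
by rewrite scaler0 add0r [c *: l]mulrC; exact.
Qed.

Lemma partial_tensor psi (k : 'I_n) : (forall i, smooth (psi i)) ->
  partial k (tensor psi) =
    tensor (fun i => if i == k then derive1 (psi i) else psi i) /\
  (forall x, derivable (tensor psi) x (delta_mx ord0 k)).
Proof.
move=> spsi; have d x := is_derive_tensor ((smooth_derive (spsi k)).1 (x ord0 k)).
split; last by move=> x; have [] := d x.
apply/funext => x; have [_] := d x; rewrite /partial => ->.
rewrite /tensor [RHS](bigD1 k)//= eqxx; congr (_ * _).
by apply: eq_bigr => i /negPf ->.
Qed.

Lemma continuous_tensor psi : (forall i, continuous (psi i)) ->
  continuous (tensor psi).
Proof.
move=> cpsi x; rewrite /tensor; apply: cvg_big => [||i _].
- exact: mul_continuous.
- exact: mx_nbhs_filter.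
apply: (@continuous_comp _ _ _ (fun v : 'rV[R]_n => v ord0 i) (psi i)).
  exact: coord_continuous.
exact: cpsi.
Qed.

Lemma box_compact (K : R) : compact (box K).
Proof.
by apply: (@rV_compact R n (fun=> `[- K, K]%classic)) => i; exact: segment_compact.
Qed.

Lemma box_precompact (A : set 'rV[R]_n) (K : R) :
  A `<=` box K -> compact (closure A).
Proof.
rewrite -precompactE => AK; apply: precompact_subset AK _.
rewrite precompactE; apply: subclosed_compact (@box_compact K) _.
  exact: closed_closure.
by apply: compact_closed => //; exact: box_compact.
Qed.

(** Each partial derivative differentiates a single factor; stability of this class reduces the
    condition on all iterated partials in [test_function] to a first-order one. *)
Lemma partials_tensor psi s : (forall i, smooth (psi i)) ->
  exists2 psi', (forall i, smooth (psi' i)) &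
    foldr partial (tensor psi) s = tensor psi'.
Proof.
move=> spsi; elim: s => [|k s [psi' spsi' /= ->]]; first by exists psi.
have [-> _] := partial_tensor k spsi'.
exists (fun i => if i == k then derive1 (psi' i) else psi' i) => //.
by move=> i; case: ifP => // _; have [] := smooth_derive (spsi' i).
Qed.

Lemma tensor_neq0_box psi (K : R) :
  (forall i t, psi i t != 0 -> `[- K, K]%classic t) ->
  [set x | tensor psi x != 0] `<=` box K.
Proof.
move=> H x /=; rewrite /tensor => /prodf_neq0 h i.
by apply: (H i); exact: h.
Qed.

Lemma test_function_tensor psi (K : R) : (forall i, smooth (psi i)) ->
  (forall i t, psi i t != 0 -> `[- K, K]%classic t) ->
  test_function (tensor psi).
Proof.
move=> spsi suppK; split => [s|].
  have [psi' spsi' ->] := partials_tensor s spsi; split.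
    apply: continuous_tensor => i; exact: (spsi' i 0).
  by move=> k x; have [_] := partial_tensor k spsi'.
exact: box_precompact (tensor_neq0_box suppK).
Qed.

End Tensor.

(** * Smooth approximations of the indicator of an interval *)

Section Bump.
Context {R : realType}.

(** For [j > 0] this is positive exactly on []a, b[]; a larger [j] steepens both flanks, and the
    limit is the indicator of that interval. *)
Definition bump (a b : R) (j : nat) (t : R) : R :=
  flat 1 (j%:R * (t - a)) * flat 1 (j%:R * (b - t)).

Lemma smooth_bump (a b : R) j : smooth (bump a b j).
Proof.
apply: smoothM.
- have := smooth_affine (j%:R) (- (j%:R * a)) (smooth_flat (1 : {poly R})).
  by under eq_fun do rewrite -mulrBr.
- have := smooth_affine (- j%:R) (j%:R * b) (smooth_flat (1 : {poly R})).
  by under eq_fun do rewrite mulNr addrC -mulrBr.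
Qed.

Lemma flat1E (t : R) : flat 1 t = if 0 < t then expR (- t^-1) else 0.
Proof. by rewrite /flat hornerC mul1r. Qed.

Lemma flat1_itv (t : R) : 0 <= flat 1 t <= 1.
Proof.
rewrite flat1E; case: ifPn => [t0|_]; last by rewrite lexx ler01.
by rewrite expR_ge0 -expR0 ler_expR oppr_le0 invr_ge0 ltW.
Qed.

Lemma bump_itv (a b : R) j t : 0 <= bump a b j t <= 1.
Proof.
have /andP[h0 h1] := flat1_itv (j%:R * (t - a)).
have /andP[k0 k1] := flat1_itv (j%:R * (b - t)).
by rewrite /bump mulr_ge0//= mulr_ile1.
Qed.

Lemma bump_neq0 (a b : R) j t : (bump a b j.+1 t != 0) = (a < t < b).
Proof.
have E u : (flat 1 (j.+1%:R * u) != 0 :> R) = (0 < u).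
  rewrite flat1E pmulr_rgt0//; case: ifP => // _; last by rewrite eqxx.
  by rewrite gt_eqF ?expR_gt0.
by rewrite /bump mulf_eq0 negb_or !E !subr_gt0.
Qed.

Lemma cvg_flat1 (t : R) :
  (flat (1 : {poly R}) (j.+1%:R * t)) @[j --> \oo] --> ((0 < t)%R%:R : R).
Proof.
have [t0|t0] := ltP 0 t; last first.
  apply: cvg_near_cst; apply: nearW => j; rewrite flat1E ifF//.
  by apply/negbTE; rewrite -leNgt mulr_ge0_le0.
under eq_fun do rewrite flat1E pmulr_rgt0// t0.
have -> : true%:R = expR (- 0) :> R by rewrite oppr0 expR0.
apply: (@cvg_comp _ _ _ (fun j : nat => - (j.+1%:R * t)^-1) expR); last exact: continuous_expR.
apply: cvgN; under eq_fun do rewrite invfM.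
have -> : nbhs (0 : R) = nbhs (0 * t^-1) by rewrite mul0r.
apply: cvgMl.
exact: cvg_harmonic.
Qed.

Lemma cvg_bump (a b t : R) :
  bump a b j.+1 t @[j --> \oo] --> ((a < t < b)%R%:R : R).
Proof.
have -> : (a < t < b)%R%:R = (0 < t - a)%R%:R * (0 < b - t)%R%:R :> R.
  by rewrite !subr_gt0 -natrM mulnb.
by apply: cvgM; exact: cvg_flat1.
Qed.

End Bump.

(** * The fundamental lemma of the calculus of variations *)

Section OpenBoxes.
Context {R : realType} {n : nat}.
Local Notation mu := (@lebesgue_row R n).

Definition obox (a b : 'I_n -> R) : set 'rV[R]_n :=
  [set x | forall i, `]a i, b i[%classic (x ord0 i)].

Lemma oboxI a b c d : obox a b `&` obox c d =
  obox (fun i => Num.max (a i) (c i)) (fun i => Num.min (b i) (d i)).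
Proof.
apply/seteqP; split => x.
  move=> [/= h1 h2] i; have := h1 i; have := h2 i; rewrite /= !in_itv/=.
  by rewrite gt_max lt_min => /andP[-> ->] /andP[-> ->].
move=> h; split => i; have := h i; rewrite /= !in_itv/= gt_max lt_min;
  by move=> /andP[/andP[? ?] /andP[? ?]]; apply/andP.
Qed.

Lemma measurable_forall_coord (A : 'I_n -> set (measurableTypeR R)) :
  (forall i, measurable (A i)) ->
  measurable [set x : 'rV[R]_n | forall i, A i (x ord0 i)].
Proof.
move=> mA.
have -> : [set x : 'rV[R]_n | forall i, A i (x ord0 i)] =
    \bigcap_(i in [set: 'I_n]) (fun v : 'rV[R]_n => v ord0 i) @^-1` A i.
  by apply/seteqP; split => v /= H i; [move=> _; exact: H|exact: H].
apply: fin_bigcap_measurable => // i _.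
by rewrite -[X in measurable X]setTI; exact: measurable_coord.
Qed.

Lemma measurable_obox a b : measurable (obox a b).
Proof.
apply: (@measurable_forall_coord (fun i => `]a i, b i[%classic)) => i.
exact: measurable_itv.
Qed.

Lemma measurable_box K : measurable (@box R n K).
Proof.
apply: (@measurable_forall_coord (fun=> `[- K, K]%classic)) => i.
exact: measurable_itv.
Qed.

Lemma lebesgue_row_box_lty K : (mu (box K) < +oo)%E.
Proof.
rewrite (@lebesgue_row_box R n (fun=> `[- K, K]%classic)); last first.
  by move=> i; exact: measurable_itv.
rewrite big_const card_ord; elim: n => [|m IH] /=; first exact: ltry.
apply: lte_mul_pinfty => //.
by rewrite ge0_fin_numE// lebesgue_measure_itv; case: ifP => _; rewrite ?ltry.
Qed.

(** Open boxes form a generator stable under intersection ([oboxI]), as Dynkin induction requires.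
    The substantial inclusion writes an open coordinate strip as a countable union of boxes. *)
Lemma sigma_obox :
  (measurable : set (set 'rV[R]_n)) =
  <<s [set A | exists a b, A = obox a b] >>.
Proof.
apply/seteqP; split; last first.
  apply: smallest_sub; first exact: sigma_algebra_measurable.
  by move=> _ [a [b ->]]; exact: measurable_obox.
set G := [set A | _].
suff : measurable_fun setT (id : g_sigma_algebraType G -> 'rV[R]_n).
  by move=> H A mA; have := H measurableT A mA; rewrite setTI preimage_id.
apply: measurable_rowP => i.
apply: (measurability _ (RGenOpens.measurableE R)) => _ [_ [a [b ->]] <-].
rewrite setTI.
have -> : (fun x : g_sigma_algebraType G => (x : 'rV[R]_n) ord0 i) @^-1` `]a, b[ =
    \bigcup_(k : nat) obox (fun j => if j == i then a else - k%:R)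
                           (fun j => if j == i then b else k%:R).
  apply/seteqP; split => [x xab|x [k _] /(_ i)]; last by rewrite eqxx.
  pose S : R := \sum_j `|(x : 'rV[R]_n) ord0 j|.
  (* This integer exceeds the sum of all [|x_j|], hence each of them. *)
  exists (Num.truncn S).+1 => // j; case: eqP => [->|_]; first exact: xab.
  rewrite /= in_itv/= -ltr_norml; apply: le_lt_trans (truncnS_gt S).
  by rewrite /S (bigD1 j)//= lerDl sumr_ge0.
apply: bigcupT_measurable => k; apply: sub_sigma_algebra.
by eexists; eexists; reflexivity.
Qed.

End OpenBoxes.

(** * Functions orthogonal to all product test functions vanish almost everywhere *)

Section FundamentalLemma.
Context {R : realType} {n : nat}.
Local Notation mu := (@lebesgue_row R n).
Variable v : 'rV[R]_n -> R.
Hypothesis mv : measurable_fun setT (v : _ -> measurableTypeR R).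
Hypothesis iv : forall K, mu.-integrable (box K) (EFin \o v).
Hypothesis v0 : forall psi : 'I_n -> R -> R, (forall i, smooth (psi i)) ->
  test_function (tensor psi) -> \int[mu]_x (v x * tensor psi x) = 0.

Let bounds (a b : 'I_n -> R) :
  exists K, forall i t, a i < t < b i -> `[- K, K]%classic t.
Proof.
exists (\sum_j (`|a j| + `|b j|)) => i t /andP[ax xb].
rewrite /= in_itv/=; have le : `|a i| + `|b i| <= \sum_j (`|a j| + `|b j|).
  by rewrite (bigD1 i)//= lerDl sumr_ge0// => j _; rewrite addr_ge0.
apply/andP; split.
- rewrite lerNl (le_trans _ le)// ler_wpDr// lerNl (le_trans _ (ltW ax))//.
  by rewrite lerNl -normrN ler_norm.
- by rewrite (le_trans _ le)// ler_wpDl// (le_trans (ltW xb))// ler_norm.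
Qed.

(** Products of bumps converge pointwise to the indicator of the box and lie between 0 and 1, so
    dominated convergence, with [|v|] on a larger closed box as majorant, passes [v0] to the
    limit. *)
Let integral_obox a b : (\int[mu]_(x in obox a b) (v x)%:E = 0)%E.
Proof.
have [K abK] := bounds a b.
have abK' : obox a b `<=` box K.
  by move=> x abx i; apply: (abK i); have := abx i; rewrite /= in_itv/=.
(* The index is shifted because [bump a b 0] is identically 0. *)
pose psi j i := bump (a i) (b i) j.+1.
pose f_ j x := (v x * tensor (psi j) x)%:E.
pose f x := (v x * \1_(obox a b) x)%:E.
have t0 j x : ~ obox a b x -> tensor (psi j) x = 0.
  move=> abx; apply/eqP; apply: contra_notT abx.
  rewrite /tensor => /prodf_neq0 h i /=; rewrite in_itv/= -(bump_neq0 _ _ j).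
  exact: h.
have tpsi j : test_function (tensor (psi j)).
  apply: (@test_function_tensor _ _ _ K); first by move=> i; exact: smooth_bump.
  by move=> i t; rewrite bump_neq0; exact: (abK i).
have mt j : measurable_fun setT (tensor (psi j) : _ -> measurableTypeR R).
  apply: continuous_measurable_row; exact: ((tpsi j).1 [::]).1.
have mf_ j : measurable_fun setT (f_ j).
  by apply/measurable_EFinP; apply: measurable_funM => //; exact: mt.
have mf : measurable_fun setT f.
  apply/measurable_EFinP; apply: measurable_funM => //.
  by apply: measurable_indic; exact: measurable_obox.
have t01 j x : 0 <= tensor (psi j) x <= 1.
  apply/andP; split.
    by apply: prodr_ge0 => i _; have /andP[] := bump_itv (a i) (b i) j.+1 (x ord0 i).
  by apply: prodr_ile1 => i _; exact: bump_itv.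
have cvg_t x : tensor (psi j) x @[j --> \oo] --> (\1_(obox a b) x : R).
  have [abx|abx] := pselect (obox a b x); last first.
    by rewrite indicE memNset//; apply: cvg_near_cst; apply: nearW => j; exact: t0.
  rewrite indicE mem_set//.
  have -> : true%:R = \prod_(i < n) 1 :> R by rewrite big1.
  apply: cvg_big => [|i _]; first exact: mul_continuous.
  have := abx i; rewrite /= in_itv/= => abi.
  by have := @cvg_bump _ (a i) (b i) (x ord0 i); rewrite abi.
pose g := (EFin \o (fun x => `|v x|)) \_ (box K).
have gi : mu.-integrable setT g.
  apply/integrable_restrict => //; first exact: measurable_box.
  by rewrite setTI; have := integrable_abse (iv K).
have dom j x : (`|f_ j x| <= g x)%E.
  rewrite /f_ /g /patch.
  have [abx|abx] := pselect (obox a b x); last first.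
    by rewrite t0// mulr0 abse0; case: ifP => // _; rewrite lee_fin.
  rewrite mem_set; last exact: abK'.
  rewrite /= lee_fin normrM ler_piMr//.
  by have /andP[? ?] := t01 j x; rewrite ger0_norm.
have f0 j : (\int[mu]_x f_ j x = 0)%E.
  have fi : mu.-integrable setT (f_ j).
    apply: le_integrable gi => // x _; apply: le_trans (dom j x) _.
    exact: lee_abs.
  (* [v0] speaks of the real integral, i.e. of [fine] of the extended one; integrability makes the
     two agree. *)
  rewrite -(fineK (integrable_fin_num _ fi))//.
  by have := v0 _ (tpsi j); rewrite /Rintegral => ->// i; exact: smooth_bump.
have [||_ _] := @dominated_convergence _ _ _ mu setT measurableT f_ f _ mf_ mf _ gi.
- apply: aeW => x _; apply: cvg_EFin; first by apply: nearW.
  by apply: cvgMr; exact: cvg_t.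
- by apply: aeW => x j _; exact: dom.
under eq_fun do rewrite f0.
move=> /cvg_lim; rewrite lim_cst// => /(_ (@ereal_hausdorff R)) /esym <-.
rewrite [LHS]integral_mkcond; apply: eq_integral => x _.
by rewrite /f patchE indicE; case: ifP => _; rewrite ?mulr1// mulr0.
Qed.

(** Dynkin induction on [A] from the boxes. Working inside a fixed cube keeps [v] integrable, which
    the countable union step uses. *)
Let integral_obox_meas (K : R) A : measurable A ->
  let O := obox (fun=> - K) (fun=> K) in
  (\int[mu]_(x in O `&` A) (v x)%:E = 0)%E.
Proof.
move=> + O; have mO : measurable O by exact: measurable_obox.
have OK : O `<=` box K.
  by move=> x Ox i; have := Ox i; rewrite /= !in_itv/= => /andP[/ltW-> /ltW->].
have iO B : measurable B -> B `<=` O -> mu.-integrable B (EFin \o v).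
  move=> mB BO; apply: (integrableS _ _ _ (iv K)) => //; first exact: measurable_box.
  exact: subset_trans OK.
have mvO B : measurable_fun B (EFin \o v).
  by apply/measurable_EFinP; exact: measurable_funTS.
rewrite sigma_obox => mA.
apply: (@dynkin_induction _ _ [set A | exists a b, A = obox a b]
  (fun A => \int[mu]_(x in O `&` A) (v x)%:E = 0)%E sigma_obox) mA.
- move=> _ _ [a [b ->]] [c [d ->]].
  by eexists; eexists; exact: oboxI.
- by rewrite setIT; exact: integral_obox.
- by move=> _ [a [b ->]]; rewrite oboxI; exact: integral_obox.
- move=> S mS IS; have : (\int[mu]_(x in O) (v x)%:E = 0)%E by exact: integral_obox.
  have mI : measurable (O `&` S) by exact: measurableI.
  have mD : measurable (O `\` S) by exact: measurableD.
  have dis : [disjoint O `&` S & O `\` S].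
    by apply/disj_setPS => x [[_ Sx] [_]].
  by rewrite -{1}(setUIDK O S) (integral_setU mu mI mD (mvO _) dis) IS add0e setDE.
- move=> F mF tF F0; rewrite setI_bigcupr integral_bigcup//.
  + by apply: eseries0 => k _ _; exact: F0.
  + exact: trivIset_setIl.
  + by move=> k; exact: measurableI.
  + apply: iO; last by apply: bigcup_sub => k _; exact: subIsetl.
    by apply: bigcupT_measurable => k; exact: measurableI.
Qed.

(** On a cube, vanishing integrals over all measurable subsets force [v = 0] a.e.; countably many
    cubes exhaust the space. *)
Lemma test_function_ae0 : ae_eq mu setT v (cst 0).
Proof.
have H (k : nat) : ae_eq mu (obox (fun=> - k%:R) (fun=> k%:R)) (EFin \o v) (cst 0%E).
  have mO := @measurable_obox R n (fun=> - k%:R) (fun=> k%:R).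
  apply: integral_ae_eq => //.
  - apply: (integrableS _ _ _ (iv k%:R)) => //; first exact: measurable_box.
    by move=> x Ox i; have := Ox i; rewrite /= !in_itv/= => /andP[/ltW-> /ltW->].
  - move=> E EO mE; rewrite integral0.
    by have /setIidPr <- := EO; exact: integral_obox_meas.
apply: filterS (ae_foralln H) => x /= vx _.
pose S : R := \sum_j `|x ord0 j|.
pose k := (Num.truncn S).+1.
suff Ox : obox (fun=> - k%:R) (fun=> k%:R) x by have [] := vx k Ox.
move=> i; rewrite /= in_itv/= -ltr_norml; apply: le_lt_trans (truncnS_gt S).
by rewrite /S (bigD1 i)//= lerDl sumr_ge0.
Qed.

End FundamentalLemma.

(** * Sobolev functions under dilations *)

Section TestFunctions.
Context {R : realType} {n : nat}.
Local Notation mu := (@lebesgue_row R n).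
Implicit Types (phi f : 'rV[R]_n -> R).

Lemma compact_bounded_fun (T : topologicalType) (f : T -> R) (A : set T) :
  continuous f -> compact A -> exists2 M, 0 <= M & forall x, A x -> `|f x| <= M.
Proof.
move=> cf cA; have /compact_bounded[M [_ HM]] : compact (f @` A).
  by apply: continuous_compact => //; exact: continuous_subspaceT.
exists (`|M| + 1); first by rewrite addr_ge0.
move=> x Ax; apply: (HM (`|M| + 1)); last by exists x.
by rewrite (le_lt_trans (ler_norm M))// ltrDl.
Qed.

Lemma test_function_box phi : test_function phi ->
  exists K, forall x, phi x != 0 -> box K x.
Proof.
move=> [_ cphi]; pose A := closure [set x | phi x != 0].
have H (i : 'I_n) : exists M, forall x, A x -> `|x ord0 i| <= M.
  have [M _ ?] := compact_bounded_fun (@coord_continuous R 1 n ord0 i) cphi.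
  by exists M.
pose M i := sval (cid (H i)).
exists (\sum_i `|M i|) => x px i; rewrite /= in_itv/= -ler_norml.
have Ax : A x by apply: subset_closure.
have h : `|x ord0 i| <= M i by exact: (svalP (cid (H i)) x Ax).
apply: le_trans h _.
by apply: le_trans (ler_norm _) _; rewrite (bigD1 i)//= lerDl sumr_ge0.
Qed.

Lemma test_function_bounded phi : test_function phi ->
  exists2 M, 0 <= M & forall x, `|phi x| <= M.
Proof.
move=> tphi; have [/(_ [::])[/= cphi _] kphi] := tphi.
have [M M0 HM] := compact_bounded_fun cphi kphi.
exists M => // x; have [->|px] := eqVneq (phi x) 0; first by rewrite normr0.
by apply: HM; exact: subset_closure.
Qed.

Lemma measurable_test_function phi : test_function phi ->
  measurable_fun setT (phi : _ -> measurableTypeR R).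
Proof. by move=> [/(_ [::])[/= cphi _] _]; exact: continuous_measurable_row. Qed.

Lemma test_function_partial phi k : test_function phi -> test_function (partial k phi).
Proof.
move=> tphi; have [K phiK] := test_function_box tphi; have [dphi _] := tphi.
split; first by move=> s; have := dphi (rcons s k); rewrite foldr_rcons.
apply: (@box_precompact _ _ _ K) => x /=.
apply: contraNP => /existsNP[i xi].
have xi' : K < `|x ord0 i|.
  by rewrite ltNge; apply/negP; rewrite ler_norml => h; apply: xi; rewrite /= in_itv.
(* The complement of the closed box is open, so [phi] vanishes on a whole neighbourhood of [x] and
   so does its partial derivative at [x]. *)
have n0 : \forall y \near x, cst 0 y = phi y.
  have : \forall y \near x, K < `|(y : 'rV[R]_n) ord0 i|.
    have c : `|(y : 'rV[R]_n) ord0 i| @[y --> x] --> `|x ord0 i|.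
      apply: cvg_norm; first exact: mx_nbhs_filter.
      exact: (@coord_continuous R 1 n ord0 i x).
    exact: (cvgr_gt _ c).
  apply: filterS => y Ky; apply/eqP; rewrite eq_sym; apply: contraTT Ky.
  move=> /phiK/(_ i); rewrite /= in_itv/= -ler_norml => h.
  by rewrite -leNgt.
by rewrite /partial -(near_eq_derive _ n0) derive_cst.
Qed.

Lemma integrable_mul_test f phi :
  measurable_fun setT (f : _ -> measurableTypeR R) ->
  (forall K, mu.-integrable (box K) (EFin \o f)) ->
  test_function phi -> mu.-integrable setT (fun x => (f x * phi x)%:E).
Proof.
move=> mf fi tphi; have [K phiK] := test_function_box tphi.
have [M M0 HM] := test_function_bounded tphi.
have gi : mu.-integrable setT ((fun x => M%:E * (f x)%:E)%E \_ (box K)).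
  apply/integrable_restrict => //; first exact: measurable_box.
  by rewrite setTI; apply: integrableZl => //; exact: measurable_box.
apply: le_integrable gi => //.
  by apply/measurable_EFinP; apply: measurable_funM => //; exact: measurable_test_function.
move=> x _; rewrite /patch; case: ifPn => [_|xK].
  by rewrite -EFinM !abse_EFin lee_fin !normrM (ger0_norm M0) mulrC ler_wpM2r.
rewrite (_ : phi x = 0) ?mulr0//; apply/eqP/negP => /negP/phiK.
by move/mem_set; rewrite (negPf xK).
Qed.

Lemma is_derive_dilate phi x v (a c l : R) :
  is_derive (c *: x) v phi l ->
  is_derive x v (fun y => a * phi (c *: y)) (a * (c * l)).
Proof.
move=> d; have d1 : is_derive (c * 0) 1 (fun s : R => phi (s *: v + c *: x)) l.
  by apply: is_derive_line d => h; rewrite mulr0 addr0 [h *: 1]mulr1.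
have d2 : is_derive (0 : R) 1 (fun s : R => c * s + 0) c := is_derive_affine c 0 0.
rewrite -(addr0 (c * 0)) in d1.
have d3 := @is_derive1_comp _ _ (fun s : R => c * s + 0) _ _ _ d1 d2.
have d4 := is_deriveZ a d3.
rewrite [c * l]mulrC; apply: is_derive_line d4 => h /=.
by rewrite scalerDr scalerA !addr0 [h *: 1]mulr1.
Qed.

Lemma foldr_partial_dilate phi (c : R) s : test_function phi ->
  foldr partial (fun x => phi (c *: x)) s =
    (fun x => c ^+ size s * foldr partial phi s (c *: x)).
Proof.
move=> [dphi _]; elim: s => [|k s IH] /=.
  by apply/funext => x; rewrite mul1r.
rewrite IH; apply/funext => x; rewrite /partial.
have [_ /(_ k (c *: x))/derivableP d] := dphi s.
have [_ ->] := is_derive_dilate (c ^+ size s) d.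
by rewrite exprSr mulrA.
Qed.

Lemma continuous_dilate f (a c : R) : continuous f ->
  continuous (fun x : 'rV[R]_n => a * f (c *: x)).
Proof.
move=> cf x; apply: continuousM; first exact: cst_continuous.
by apply: continuous_comp; [exact: scaler_continuous|exact: cf].
Qed.

Lemma test_function_dilate phi (c : R) : 0 < c -> test_function phi ->
  test_function (fun x => phi (c *: x)).
Proof.
move=> c0 tphi; have [K phiK] := test_function_box tphi; split.
  move=> s; have [cs ds] := tphi.1 s; rewrite foldr_partial_dilate//; split.
    exact: continuous_dilate.
  move=> k x; have /derivableP d := ds k (c *: x).
  by have [] := is_derive_dilate (c ^+ size s) d.
apply: (@box_precompact _ _ _ (K / c)) => x /= /phiK xK i.
have := xK i; rewrite /= !in_itv/= !mxE => /andP[h1 h2].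
by rewrite -mulNr ler_pdivrMr// ler_pdivlMr// mulrC h1 h2.
Qed.

End TestFunctions.

(** * Measurability and modulus of complex-valued functions *)

Section ComplexFunctions.
Context {R : realType} d (T : measurableType d).
Implicit Types f : T -> R[i].

Lemma measurable_Re : measurable_fun setT (@complex.Re R : _ -> measurableTypeR R).
Proof.
move=> _ Y mY; rewrite setTI.
exists (Y `*` setT); first exact: measurableX.
by apply/seteqP; split => [z [_ []]|z Yz].
Qed.

Lemma measurable_Im : measurable_fun setT (@complex.Im R : _ -> measurableTypeR R).
Proof.
move=> _ Y mY; rewrite setTI.
exists (setT `*` Y); first exact: measurableX.
by apply/seteqP; split => [z [_ []]|z Yz].
Qed.

Lemma measurable_complex f :
  measurable_fun setT (fun x => complex.Re (f x) : measurableTypeR R) ->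
  measurable_fun setT (fun x => complex.Im (f x) : measurableTypeR R) ->
  measurable_fun setT f.
Proof.
move=> mRe mIm _ _ [C mC <-].
have mf : measurable_fun setT (fun x => (complex.Re (f x) : measurableTypeR R,
    complex.Im (f x) : measurableTypeR R)).
  exact: measurable_fun_pair.
have := mf measurableT C mC; congr (measurable _).
by apply/seteqP; split => x; [move=> [_ Cx]|move=> [_ [_ Cx]]].
Qed.

Lemma normcE (z : R[i]) :
  Normc.normc z = Num.sqrt (complex.Re z ^+ 2 + complex.Im z ^+ 2).
Proof. by case: z. Qed.

Lemma measurable_normc f : measurable_fun setT f ->
  measurable_fun setT (fun x => Normc.normc (f x) : measurableTypeR R).
Proof.
move=> mf; under eq_fun do rewrite normcE.
have ms : measurable_fun setT (Num.sqrt : measurableTypeR R -> measurableTypeR R).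
  by apply: continuous_measurable_fun; exact: sqrt_continuous.
apply: (measurableT_comp ms).
have mRe := measurableT_comp measurable_Re mf.
have mIm := measurableT_comp measurable_Im mf.
by apply: measurable_funD; exact: measurable_funX.
Qed.

Lemma normc_ge0 (z : R[i]) : 0 <= Normc.normc z.
Proof. by rewrite normcE sqrtr_ge0. Qed.

Lemma normc_real (t : R) : Normc.normc (real_complex R t) = `|t|.
Proof. by rewrite normcE /= expr0n addr0 sqrtr_sqr. Qed.

Lemma normcZ (t : R) (z : R[i]) :
  Normc.normc (real_complex R t * z) = `|t| * Normc.normc z.
Proof. by rewrite Normc.normcM normc_real. Qed.

Lemma ReZ (t : R) (z : R[i]) : complex.Re (real_complex R t * z) = t * complex.Re z.
Proof. by case: z => a b /=; rewrite mul0r subr0. Qed.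

Lemma ImZ (t : R) (z : R[i]) : complex.Im (real_complex R t * z) = t * complex.Im z.
Proof. by case: z => a b /=; rewrite mul0r addr0. Qed.

Lemma normr_Re_le (z : R[i]) : `|complex.Re z| <= Normc.normc z.
Proof. by rewrite normcE -sqrtr_sqr ler_wsqrtr// lerDl sqr_ge0. Qed.

Lemma normr_Im_le (z : R[i]) : `|complex.Im z| <= Normc.normc z.
Proof. by rewrite normcE -sqrtr_sqr ler_wsqrtr// lerDr sqr_ge0. Qed.

End ComplexFunctions.

(** * Real integrals and Lebesgue norms of dilated functions *)

Section Dilation.
Context {R : realType} {n : nat}.
Local Notation mu := (@lebesgue_row R n).
Implicit Types (u v : 'rV[R]_n -> R[i]) (f : 'rV[R]_n -> R).

(** At infinite [x] the product stays infinite and [fine] sends both to 0. *)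
Lemma fineZ (c : R) (x : \bar R) : 0 < c -> fine (c%:E * x)%E = c * fine x.
Proof.
move=> c0; case: x => [r| |]; first by rewrite -EFinM.
  by rewrite gt0_muley ?lte_fin//= mulr0.
by rewrite gt0_muleNy ?lte_fin//= mulr0.
Qed.

(* No integrability is assumed: both sides are 0 when the integral diverges. *)
Lemma Rintegral_dilate f (c l : R) : 0 < c -> 0 < l ->
  measurable_fun setT (f : _ -> measurableTypeR R) ->
  \int[mu]_x (c * f (l *: x)) = c * l ^- n * \int[mu]_x f x.
Proof.
move=> c0 l0 mf; have ln0 : 0 < l ^- n by rewrite invr_gt0 exprn_gt0.
rewrite /Rintegral -fineZ ?mulr_gt0//; congr fine.
have mF : measurable_fun setT (EFin \o f) by exact/measurable_EFinP.
have E (g : 'rV[R]_n -> \bar R) : measurable_fun setT g -> (forall x, (0 <= g x)%E) ->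
    (\int[mu]_x (c%:E * g (l *: x)%R) = (c * l ^- n)%:E * \int[mu]_x g x)%E.
  move=> mg g0; rewrite ge0_integralZl//.
  - by rewrite ge0_integral_dilate// muleA.
  - by apply: measurableT_comp => //; exact: measurable_scale_row.
  - by rewrite lee_fin ltW.
pose F x := (EFin \o f) (l *: x).
rewrite (_ : (fun x => _) = (fun x => c%:E * F x)%E); last first.
  by apply/funext => x; rewrite -EFinM.
rewrite [LHS]integralE [in RHS]integralE.
rewrite (ge0_funeposM _ (ltW c0)) (ge0_funenegM _ (ltW c0)).
have -> : F^\+%E = (fun x => (EFin \o f)^\+%E (l *: x)).
  exact: (funepos_comp (EFin \o f) ( *:%R l)).
have -> : F^\-%E = (fun x => (EFin \o f)^\-%E (l *: x)).
  exact: (funeneg_comp (EFin \o f) ( *:%R l)).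
rewrite (E (EFin \o f)^\+%E)//; last exact: measurable_funepos.
rewrite (E (EFin \o f)^\-%E)//; last exact: measurable_funeneg.
have cl0 : 0 < c * l ^- n by exact: mulr_gt0.
have : (0 <= \int[mu]_x (EFin \o f)^\+ x)%E by exact: integral_ge0.
have : (0 <= \int[mu]_x (EFin \o f)^\- x)%E by exact: integral_ge0.
(* Scaling by a positive constant commutes with the difference of the two parts, also when one or
   both are infinite. *)
move: (\int[mu]_x _)%E (\int[mu]_x _)%E => [b| |] [a| |]// _ _.
- exact: (congr1 EFin (esym (mulrBr _ _ _))).
- by rewrite gt0_muley ?lte_fin//= gt0_muleNy ?lte_fin.
- by rewrite gt0_muley ?lte_fin//= gt0_muley ?lte_fin.
- by rewrite gt0_muley ?lte_fin//= gt0_muleNy ?lte_fin.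
Qed.

Definition dilate (m l : R) u : 'rV[R]_n -> R[i] :=
  fun x => real_complex R m * u (l *: x).

Lemma measurable_dilate m l u : measurable_fun setT u ->
  measurable_fun setT (dilate m l u).
Proof.
move=> mu_; have mul : measurable_fun setT (fun x : 'rV[R]_n => u (l *: x)).
  by apply: measurableT_comp => //; exact: measurable_scale_row.
apply: measurable_complex; rewrite /dilate.
- under eq_fun do rewrite ReZ; apply: measurable_funM => //.
  exact: (measurableT_comp measurable_Re mul).
- under eq_fun do rewrite ImZ; apply: measurable_funM => //.
  exact: (measurableT_comp measurable_Im mul).
Qed.

Lemma measurable_normc_powR u (q : R) : measurable_fun setT u ->
  measurable_fun setT (fun x => Normc.normc (u x) `^ q : measurableTypeR R).
Proof.
by move=> mu_; apply: (measurableT_comp (measurable_powR q)); exact: measurable_normc.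
Qed.

Lemma Lpow_dilate (q m l : R) u : 0 < m -> 0 < l -> measurable_fun setT u ->
  Lpow q (dilate m l u) = m `^ q * l ^- n * Lpow q u.
Proof.
move=> m0 l0 mu_; rewrite /Lpow -Rintegral_dilate ?powR_gt0//.
  congr Rintegral; apply/funext => x; rewrite /dilate normcZ (gtr0_norm m0).
  by rewrite powRM ?normc_ge0// ltW.
exact: measurable_normc_powR.
Qed.

Lemma Lpow_ge0 (q : R) u : 0 <= Lpow q u.
Proof. by apply: Rintegral_ge0 => x _; exact: powR_ge0. Qed.

Lemma L2_dilate (m l : R) u : 0 < m -> 0 < l -> L2 u -> L2 (dilate m l u).
Proof.
move=> m0 l0 [mu_ iu]; split; first exact: measurable_dilate.
under eq_integral do rewrite /dilate normcZ exprMn EFinM.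
pose g x := (Normc.normc (u x) ^+ 2)%:E.
have mg : measurable_fun setT g.
  by apply/measurable_EFinP; apply: measurable_funX; exact: measurable_normc.
rewrite ge0_integralZl//.
- rewrite (@ge0_integral_dilate _ _ _ g)//; last by move=> x; rewrite lee_fin sqr_ge0.
  rewrite lte_mul_pinfty// ?lee_fin ?sqr_ge0//.
  by rewrite lte_mul_pinfty// lee_fin invr_ge0 exprn_ge0// ltW.
- apply: (measurableT_comp mg); exact: measurable_scale_row.
- by move=> x _; rewrite lee_fin sqr_ge0.
Qed.

End Dilation.

(** * Uniqueness and scaling of weak gradients *)

Section WeakGradients.
Context {R : realType} {n : nat}.
Local Notation mu := (@lebesgue_row R n).
Implicit Types (u v : 'rV[R]_n -> R[i]) (g h : 'I_n -> 'rV[R]_n -> R[i]).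

(** From [t <= 1 + t ^+ 2] and the finite measure of boxes. *)
Lemma L2_integrable_box u (f : 'rV[R]_n -> R) K : L2 u ->
  measurable_fun setT (f : _ -> measurableTypeR R) ->
  (forall x, `|f x| <= Normc.normc (u x)) -> mu.-integrable (box K) (EFin \o f).
Proof.
move=> [mu_ iu] mf fu; have mb := @measurable_box R n K.
have i1 : mu.-integrable (box K) (cst 1%E).
  by apply/integrableP; split => //; rewrite integral_cst//= normr1 mul1e lebesgue_row_box_lty.
have i2 : mu.-integrable setT (fun x => (Normc.normc (u x) ^+ 2)%:E).
  apply/integrableP; split.
    by apply/measurable_EFinP; apply: measurable_funX; exact: measurable_normc.
  by under eq_integral do rewrite abse_EFin ger0_norm ?sqr_ge0//.
have i2' := integrableS measurableT mb (@subsetT _ _) i2.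
have i3 := integrableD mb i1 i2'.
apply: le_integrable i3 => //; first by apply/measurable_EFinP; exact: measurable_funTS.
move=> x _; rewrite /= lee_fin (le_trans (fu x))//.
rewrite ger0_norm ?addr_ge0 ?sqr_ge0//.
by have := sqr_ge0 (Normc.normc (u x) - 1); move: (Normc.normc _) => t; nra.
Qed.

Lemma measurable_L2 u : L2 u -> measurable_fun setT u. Proof. by case. Qed.

Lemma L2_Re u : L2 u ->
  measurable_fun setT (fun x => complex.Re (u x) : measurableTypeR R) /\
  (forall K, mu.-integrable (box K) (fun x => (complex.Re (u x))%:E)).
Proof.
move=> Lu; have mf := measurableT_comp measurable_Re (measurable_L2 Lu).
by split=> // K; apply: (L2_integrable_box _ Lu mf) => x; exact: normr_Re_le.
Qed.

Lemma L2_Im u : L2 u ->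
  measurable_fun setT (fun x => complex.Im (u x) : measurableTypeR R) /\
  (forall K, mu.-integrable (box K) (fun x => (complex.Im (u x))%:E)).
Proof.
move=> Lu; have mf := measurableT_comp measurable_Im (measurable_L2 Lu).
by split=> // K; apply: (L2_integrable_box _ Lu mf) => x; exact: normr_Im_le.
Qed.

Lemma test_function_ae_eq (a b : 'rV[R]_n -> R) :
  measurable_fun setT (a : _ -> measurableTypeR R) ->
  measurable_fun setT (b : _ -> measurableTypeR R) ->
  (forall K, mu.-integrable (box K) (EFin \o a)) ->
  (forall K, mu.-integrable (box K) (EFin \o b)) ->
  (forall phi, test_function phi ->
    \int[mu]_x (a x * phi x) = \int[mu]_x (b x * phi x)) ->
  ae_eq mu setT a b.
Proof.
move=> ma mb ia ib ab.
have mab : measurable_fun setT ((fun x => a x - b x) : _ -> measurableTypeR R).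
  exact: measurable_funB.
have iab K : mu.-integrable (box K) (EFin \o (fun x => a x - b x)).
  by have := integrableB (@measurable_box R n K) (ia K) (ib K).
have := test_function_ae0 mab iab.
have H (psi : 'I_n -> R -> R) : (forall i, smooth (psi i)) -> test_function (tensor psi) ->
    \int[mu]_x ((a x - b x) * tensor psi x) = 0.
  move=> _ tpsi; have iaf := integrable_mul_test ma ia tpsi.
  have ibf := integrable_mul_test mb ib tpsi.
  under eq_Rintegral do rewrite mulrBl.
  by rewrite RintegralB// ab// subrr.
move=> /(_ H); apply: filterS => x /= /(_ I) /eqP + _.
by rewrite subr_eq0 => /eqP.
Qed.

(** The fundamental lemma is applied to real and imaginary parts separately, test functions being
    real. *)
Lemma weak_gradient_unique u g h : is_weak_gradient u g -> is_weak_gradient u h ->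
  forall k, ae_eq mu setT (g k) (h k).
Proof.
move=> ug uh k; have [Lg wg] := ug k; have [Lh wh] := uh k.
have [mRg iRg] := L2_Re Lg; have [mIg iIg] := L2_Im Lg.
have [mRh iRh] := L2_Re Lh; have [mIh iIh] := L2_Im Lh.
have HR := test_function_ae_eq mRg mRh iRg iRh.
have HI := test_function_ae_eq mIg mIh iIg iIh.
have {}HR : ae_eq mu setT (fun x => complex.Re (g k x)) (fun x => complex.Re (h k x)).
  apply: HR => phi tphi; have [a _] := wg phi tphi; have [b _] := wh phi tphi.
  by apply: oppr_inj; rewrite -a -b.
have {}HI : ae_eq mu setT (fun x => complex.Im (g k x)) (fun x => complex.Im (h k x)).
  apply: HI => phi tphi; have [_ a] := wg phi tphi; have [_ b] := wh phi tphi.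
  by apply: oppr_inj; rewrite -a -b.
apply: filterS2 HR HI => x /= HR HI _; move: (HR I) (HI I).
by case: (g k x) (h k x) => a b [c e] /= -> ->.
Qed.

Lemma Lpow_ae (q : R) u v : measurable_fun setT u -> measurable_fun setT v ->
  ae_eq mu setT u v -> Lpow q u = Lpow q v.
Proof.
move=> mu_ mv uv; rewrite /Lpow /Rintegral; congr fine.
apply: ae_eq_integral => //.
- by apply/measurable_EFinP; exact: measurable_normc_powR.
- by apply/measurable_EFinP; exact: measurable_normc_powR.
- by apply: filterS uv => x /= uv _; rewrite uv.
Qed.

(** Frees [dirichlet] from the chosen representative: a.e. uniqueness lets any weak gradient compute
    it. *)
Lemma dirichletE u g : is_weak_gradient u g ->
  dirichlet u = \sum_(k < n) Lpow 2 (g k).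
Proof.
move=> ug; have uw : is_weak_gradient u (weak_gradient u).
  by rewrite /weak_gradient; case: xgetP => // /(_ g).
apply: eq_bigr => k _; apply: Lpow_ae.
- by have [[]] := uw k.
- by have [[]] := ug k.
- exact: weak_gradient_unique.
Qed.

Lemma L2_ae u v : measurable_fun setT v -> ae_eq mu setT u v -> L2 u -> L2 v.
Proof.
move=> mv uv [mu_ iu]; split => //.
rewrite -(@ae_eq_integral _ _ _ _ _ _ (fun x => (Normc.normc (u x) ^+ 2)%:E))//.
- by apply/measurable_EFinP; apply: measurable_funX; exact: measurable_normc.
- by apply/measurable_EFinP; apply: measurable_funX; exact: measurable_normc.
- by apply: filterS uv => x /= uv _; rewrite uv.
Qed.

Lemma is_weak_gradient_ae u v g : measurable_fun setT u -> measurable_fun setT v ->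
  ae_eq mu setT u v -> is_weak_gradient u g -> is_weak_gradient v g.
Proof.
move=> mu_ mv uv ug k; have [Lg wg] := ug k; split=> // phi tphi.
have mp := measurable_test_function (test_function_partial k tphi).
have [<- <-] := wg phi tphi; split; rewrite /Rintegral; congr fine;
  apply: ae_eq_integral => //.
- apply/measurable_EFinP; apply: measurable_funM => //.
  exact: (measurableT_comp measurable_Re).
- apply/measurable_EFinP; apply: measurable_funM => //.
  exact: (measurableT_comp measurable_Re).
- by apply: filterS uv => x /= uv _; rewrite uv.
- apply/measurable_EFinP; apply: measurable_funM => //.
  exact: (measurableT_comp measurable_Im).
- apply/measurable_EFinP; apply: measurable_funM => //.
  exact: (measurableT_comp measurable_Im).
- by apply: filterS uv => x /= uv _; rewrite uv.
Qed.

Lemma in_H1_ae u v : measurable_fun setT v -> ae_eq mu setT u v -> in_H1 u ->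
  in_H1 v /\ dirichlet v = dirichlet u.
Proof.
move=> mv uv [Lu [g ug]]; have vg := is_weak_gradient_ae (measurable_L2 Lu) mv uv ug.
split; last by rewrite (dirichletE ug) (dirichletE vg).
by split; [exact: L2_ae uv Lu|exists g].
Qed.

(** Test the weak gradient of [u] against [phi (l^-1 *: x)] and change variables on both sides of
    the identity. *)
Lemma is_weak_gradient_dilate (m l : R) u g : 0 < m -> 0 < l ->
  measurable_fun setT u -> is_weak_gradient u g ->
  is_weak_gradient (dilate m l u) (fun k => dilate (m * l) l (g k)).
Proof.
move=> m0 l0 mu_ ug k; have [Lg wg] := ug k.
split; first by apply: L2_dilate => //; exact: mulr_gt0.
move=> phi tphi; have tphi' : test_function (fun x => phi (l^-1 *: x)).
  by apply: test_function_dilate => //; rewrite invr_gt0.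
have [wR wI] := wg _ tphi'.
(* The leading [l] compensates the factor [l^-1] of the chain rule; it becomes the extra [l] in the
   amplitude [m * l] of the gradient. *)
have pE x : l * partial k (fun x => phi (l^-1 *: x)) (l *: x) = partial k phi x.
  have := @foldr_partial_dilate _ _ _ (l^-1) [:: k] tphi => /= ->.
  by rewrite expr1 scalerA mulVf ?gt_eqF// scale1r mulVKf ?gt_eqF.
have mp : measurable_fun setT (partial k (fun x => phi (l^-1 *: x)) : _ -> measurableTypeR R).
  by apply: measurable_test_function; exact: test_function_partial.
have mp' := measurable_test_function tphi'.
have pE' x : phi x = phi (l^-1 *: (l *: x)).
  by rewrite scalerA mulVf ?gt_eqF// scale1r.
split.
- rewrite (_ : \int[mu]_x _ = \int[mu]_x (m * l * (complex.Re (u (l *: x)) *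
      partial k (fun x => phi (l^-1 *: x)) (l *: x)))); last first.
    by apply: eq_Rintegral => x _; rewrite /dilate ReZ -pE; ring.
  rewrite (Rintegral_dilate (f := fun x => complex.Re (u x) *
    partial k (fun x => phi (l^-1 *: x)) x))// ?mulr_gt0//; last first.
    by apply: measurable_funM => //; exact: (measurableT_comp measurable_Re).
  rewrite wR mulrN; congr (- _); rewrite -Rintegral_dilate ?mulr_gt0//.
    by apply: eq_Rintegral => x _; rewrite /dilate ReZ -pE' mulrA.
  apply: measurable_funM => //.
  exact: (measurableT_comp measurable_Re (measurable_L2 Lg)).
- rewrite (_ : \int[mu]_x _ = \int[mu]_x (m * l * (complex.Im (u (l *: x)) *
      partial k (fun x => phi (l^-1 *: x)) (l *: x)))); last first.
    by apply: eq_Rintegral => x _; rewrite /dilate ImZ -pE; ring.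
  rewrite (Rintegral_dilate (f := fun x => complex.Im (u x) *
    partial k (fun x => phi (l^-1 *: x)) x))// ?mulr_gt0//; last first.
    by apply: measurable_funM => //; exact: (measurableT_comp measurable_Im).
  rewrite wI mulrN; congr (- _); rewrite -Rintegral_dilate ?mulr_gt0//.
    by apply: eq_Rintegral => x _; rewrite /dilate ImZ -pE' mulrA.
  apply: measurable_funM => //.
  exact: (measurableT_comp measurable_Im (measurable_L2 Lg)).
Qed.

Lemma in_H1_dilate (m l : R) u : 0 < m -> 0 < l -> in_H1 u ->
  in_H1 (dilate m l u) /\
  dirichlet (dilate m l u) = (m * l) ^+ 2 * l ^- n * dirichlet u.
Proof.
move=> m0 l0 [Lu [g ug]].
have dg := is_weak_gradient_dilate m0 l0 (measurable_L2 Lu) ug; split.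
  by split; [exact: L2_dilate|eexists; exact: dg].
rewrite (dirichletE dg) (dirichletE ug) mulr_sumr; apply: eq_bigr => k _.
rewrite Lpow_dilate ?mulr_gt0//; first by rewrite powR_mulrn// ltW// mulr_gt0.
by have [[]] := ug k.
Qed.

End WeakGradients.

(** * Test functions belong to H^1 *)

Section IntegrationByParts.
Context {R : realType}.

Lemma integral_derive0 (F f : R -> R) (K : R) :
  (forall x : R, is_derive x 1 F (f x)) -> continuous f ->
  (forall x, F x != 0 -> `[- K, K]%classic x) ->
  (forall x, f x != 0 -> `[- K, K]%classic x) ->
  (\int[lebesgue_measure]_x (f x)%:E = 0)%E.
Proof.
move=> dF cf FK fK; pose L := `|K| + 1.
have KL : K < L by rewrite /L (le_lt_trans (ler_norm K))// ltrDl.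
have L0 : 0 < L by rewrite /L ltr_wpDl.
have out (g : R -> R) x : (forall x, g x != 0 -> `[- K, K]%classic x) ->
    L <= `|x| -> g x = 0.
  move=> gK Lx; apply/eqP; apply: contraTT Lx => /gK.
  by rewrite /= in_itv/= -ler_norml -ltNge => h; exact: le_lt_trans KL.
have -> : (\int[lebesgue_measure]_x (f x)%:E =
           \int[lebesgue_measure]_(x in `[(- L)%R, L]) (f x)%:E)%E.
  rewrite [RHS]integral_mkcond; apply: eq_integral => x _.
  rewrite patchE; case: ifPn => // xL; rewrite (out f)//.
  rewrite leNgt; apply: contra xL => xL; rewrite inE /= in_itv/=.
  by rewrite -ler_norml ltW.
have cF : continuous F.
  by move=> x; apply: differentiable_continuous; apply/derivable1_diffP; have [] := dF x.
rewrite (@continuous_FTC2 _ _ F).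
- by rewrite !(out F)// ?normrN ?(gtr0_norm L0)// subee.
- by rewrite gtrN.
- exact: continuous_subspaceT.
- split.
  + by move=> x _; have [] := dF x.
  + by apply: cvg_at_right_filter; exact: cF.
  + by apply: cvg_at_left_filter; exact: cF.
- by move=> x _; rewrite derive1E; have [_] := dF x.
Qed.

Lemma continuous_rowP (T : topologicalType) n (f : T -> 'rV[R]_n) :
  (forall i, continuous (fun t => f t ord0 i)) -> continuous f.
Proof.
move=> cf x A [P nP PA].
have H : \forall y \near x, forall i : 'I_n, P ord0 i (f y ord0 i).
  by apply: filter_forall => i; exact: (cf i x _ (nP ord0 i)).
by apply: filterS H => y Py; apply: PA => i j; rewrite ord1.
Qed.

Lemma continuous_row_consl n (v : 'rV[R]_n) :
  continuous (fun x : R => row_cons (x, v)).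
Proof.
apply: continuous_rowP => i; case: (unliftP ord0 i) => [j ->|->].
- by under eq_fun do rewrite mxE liftK /=; exact: cst_continuous.
- by under eq_fun do rewrite mxE unlift_none /=; move=> x; exact: cvg_id.
Qed.

Lemma continuous_row_consr n (x : R) :
  continuous (fun v : 'rV[R]_n => row_cons (x, v)).
Proof.
apply: continuous_rowP => i; case: (unliftP ord0 i) => [j ->|->].
- by under eq_fun do rewrite mxE liftK /=; exact: coord_continuous.
- by under eq_fun do rewrite mxE unlift_none /=; exact: cst_continuous.
Qed.

Lemma row_consDl n (x h : R) (v : 'rV[R]_n) :
  h *: delta_mx ord0 ord0 + row_cons (x, v) = row_cons (h + x, v).
Proof.
apply/rowP => i; rewrite !mxE eqxx/=; case: unliftP => [j ->|->] /=.
  by rewrite mulr0 add0r.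
by rewrite ?eqxx mulr1.
Qed.

Lemma row_consDr n (x h : R) (v : 'rV[R]_n) j :
  h *: delta_mx ord0 (lift ord0 j) + row_cons (x, v) =
  row_cons (x, h *: delta_mx ord0 j + v).
Proof.
apply/rowP => i; rewrite !mxE eqxx/=; case: unliftP => [k ->|->] /=.
  by rewrite !mxE eqxx/= (inj_eq (@lift_inj _ _)).
by rewrite mulr0 add0r.
Qed.

Lemma integrable_box n (f : 'rV[R]_n -> R) K : continuous f ->
  (forall x, f x != 0 -> box K x) ->
  (lebesgue_row n).-integrable setT (EFin \o f).
Proof.
move=> cf fK; have [M M0 HM] := compact_bounded_fun cf (@box_compact _ _ K).
have mb := @measurable_box R n K.
have gi : (lebesgue_row n).-integrable setT (cst M%:E \_ (box K)).
  apply/integrable_restrict => //; rewrite setTI.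
  apply/integrableP; split => //; rewrite integral_cst// lte_mul_pinfty//.
  exact: lebesgue_row_box_lty.
apply: le_integrable gi => //.
  by apply/measurable_EFinP; exact: continuous_measurable_row.
move=> x _; rewrite patchE; case: ifPn => [|xK].
  by rewrite inE => xK; rewrite /= lee_fin (ger0_norm M0) HM.
rewrite /= (_ : f x = 0) ?normr0//; apply/eqP/negP => /negP/fK.
by move/mem_set; rewrite (negPf xK).
Qed.

(** By Fubini, splitting off the first coordinate. If it is the differentiated one, integrate in it
    first and use the one-dimensional case; otherwise the induction hypothesis applies to each
    slice. *)
Lemma integral_partial0 n (k : 'I_n) (w dw : 'rV[R]_n -> R) (K : R) :
  (forall x, is_derive x (delta_mx ord0 k) w (dw x)) -> continuous dw ->
  (forall x, w x != 0 -> box K x) -> (forall x, dw x != 0 -> box K x) ->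
  (\int[lebesgue_row n]_x (dw x)%:E = 0)%E.
Proof.
elim: n k w dw => [[]//|n IH] k w dw dW cdw wK dwK.
have mdw : measurable_fun setT (EFin \o dw).
  by apply/measurable_EFinP; exact: continuous_measurable_row.
have idw : (@lebesgue_measure R \x lebesgue_row n)%E.-integrable setT
    ((EFin \o dw) \o @row_cons R n).
  have mc := measurableT_comp mdw (@measurable_row_cons R n).
  apply/integrableP; split => //.
  have /integrableP[_] := integrable_box cdw dwK.
  rewrite [X in (X < _)%E -> _](@ge0_integral_pushforward _ _ _ _ _ (@row_cons R n)
    (@measurable_row_cons R n))// ?preimage_setT//.
  exact: measurableT_comp.
rewrite [LHS](@integral_pushforward _ _ _ _ _ (@row_cons R n)
  (@measurable_row_cons R n))// preimage_setT.
case: (unliftP ord0 k) => [j kE|kE]; rewrite {}kE in dW.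
- rewrite -(integral12_prod_meas1 idw); apply: integral0_eq => x _.
  apply: (IH j (fun v => w (row_cons (x, v)))).
  + by move=> v; apply: is_derive_line (dW (row_cons (x, v))) => h; rewrite row_consDr.
  + move=> v; apply: (@continuous_comp _ _ _ (fun v : 'rV[R]_n => row_cons (x, v)) dw).
      exact: continuous_row_consr.
    exact: cdw.
  + by move=> v /wK vK i; have := vK (lift ord0 i); rewrite mxE liftK.
  + by move=> v /dwK vK i; have := vK (lift ord0 i); rewrite mxE liftK.
- rewrite -(integral21_prod_meas1 idw); apply: integral0_eq => v _.
  apply: (@integral_derive0 (fun x => w (row_cons (x, v))) _ K).
  + move=> x; apply: is_derive_line (dW (row_cons (x, v))) => h.
    by rewrite row_consDl [h *: 1]mulr1.
  + move=> x; apply: (@continuous_comp _ _ _ (fun x : R => row_cons (x, v)) dw).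
      exact: continuous_row_consl.
    exact: cdw.
  + by move=> x /wK vK; have := vK ord0; rewrite mxE unlift_none.
  + by move=> x /dwK vK; have := vK ord0; rewrite mxE unlift_none.
Qed.

End IntegrationByParts.

(** * Integration by parts and nontrivial elements of H^1 *)

Section TestFunctionsInH1.
Context {R : realType} {n : nat}.
Local Notation mu := (@lebesgue_row R n).
Implicit Types (u : 'rV[R]_n -> R[i]) (phi eta : 'rV[R]_n -> R).

(** The product [phi * eta] is supported in a box, so its partial derivative integrates to 0; expand
    it by the product rule. *)
Lemma test_function_parts phi eta k : test_function phi -> test_function eta ->
  \int[mu]_x (phi x * partial k eta x) = - \int[mu]_x (partial k phi x * eta x).
Proof.
move=> tphi teta; have tdphi := test_function_partial k tphi.
have tdeta := test_function_partial k teta.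
have [/(_ [::])[/= cphi dphi] _] := tphi; have [/(_ [::])[/= ceta deta] _] := teta.
have [/(_ [::])[/= cdphi _] _] := tdphi; have [/(_ [::])[/= cdeta _] _] := tdeta.
have [K phiK] := test_function_box tphi; have [K' dphiK] := test_function_box tdphi.
have cM (f g : 'rV[R]_n -> R) : continuous f -> continuous g ->
    continuous (fun x => f x * g x).
  by move=> cf cg x; apply: continuousM; [exact: cf|exact: cg].
have i1 : mu.-integrable setT (EFin \o (fun x => phi x * partial k eta x)).
  apply: (@integrable_box _ _ _ K); first exact: cM.
  by move=> x; rewrite mulf_eq0 negb_or => /andP[/phiK].
have i2 : mu.-integrable setT (EFin \o (fun x => eta x * partial k phi x)).
  apply: (@integrable_box _ _ _ K'); first exact: cM.
  by move=> x; rewrite mulf_eq0 negb_or => /andP[_ /dphiK].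
have box_le (a b : R) : a <= b -> @box R n a `<=` box b.
  move=> ab x xa i; have := xa i; rewrite /= !in_itv/= => /andP[h1 h2].
  by rewrite (le_trans h2 ab) (le_trans _ h1)// lerN2.
have H : (\int[mu]_x (phi x * partial k eta x + eta x * partial k phi x)%:E = 0)%E.
  apply: (@integral_partial0 _ _ k (fun x => phi x * eta x) _ (Num.max K K')).
  - move=> x; have /derivableP d1 := dphi k x; have /derivableP d2 := deta k x.
    exact: is_deriveM.
  - move=> x; apply: (@continuousD _ _ _ (fun x => phi x * partial k eta x)
      (fun x => eta x * partial k phi x)); exact: cM.
  - move=> x; rewrite mulf_eq0 negb_or => /andP[/phiK + _].
    by apply: box_le; rewrite le_max lexx.
  - move=> x; have [-> |/phiK + _] := eqVneq (phi x) 0; last first.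
      by apply: box_le; rewrite le_max lexx.
    rewrite mul0r add0r mulf_eq0 negb_or => /andP[_ /dphiK].
    by apply: box_le; rewrite le_max lexx orbT.
apply/eqP; rewrite -addr_eq0; apply/eqP.
under [X in _ + X]eq_Rintegral do rewrite mulrC.
by rewrite -RintegralD// /Rintegral H.
Qed.

Lemma test_function_L2 phi : test_function phi -> L2 (fun x => real_complex R (phi x)).
Proof.
move=> tphi; have mp := measurable_test_function tphi; split.
  by apply: measurable_complex; [exact: mp|exact: measurable_cst].
have [K phiK] := test_function_box tphi; have [/(_ [::])[/= cphi _] _] := tphi.
have /integrableP[_] : mu.-integrable setT (EFin \o (fun x => phi x * phi x)).
  apply: (@integrable_box _ _ _ K).
    by move=> x; apply: continuousM; exact: cphi.
  by move=> x; rewrite mulf_eq0 negb_or => /andP[/phiK].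
congr (_ < _)%E; apply: eq_integral => x _.
by rewrite /= expr0n/= addr0 sqr_sqrtr ?sqr_ge0// -expr2 ger0_norm ?sqr_ge0.
Qed.

Lemma test_function_H1 phi : test_function phi ->
  in_H1 (fun x => real_complex R (phi x)).
Proof.
move=> tphi; split; first exact: test_function_L2.
exists (fun k x => real_complex R (partial k phi x)) => k; split.
  exact: test_function_L2 (test_function_partial k tphi).
move=> eta teta; split => /=; first exact: test_function_parts.
have E (f : 'rV[R]_n -> R) : \int[mu]_x (0 * f x) = 0.
  by rewrite /Rintegral integral0_eq// => x _; rewrite mul0r.
by rewrite !E oppr0.
Qed.

(** Finiteness rules out the default value 0 of [Lpow] for a divergent integral. *)
Lemma Lpow_eq0 (q : R) u : q != 0 -> measurable_fun setT u ->
  (\int[mu]_x (Normc.normc (u x) `^ q)%:E < +oo)%E ->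
  Lpow q u = 0 -> ae_eq mu setT u (cst 0).
Proof.
move=> q0 mu_ fin_u; rewrite /Lpow /Rintegral => u0.
have {}u0 : (\int[mu]_x `|(Normc.normc (u x) `^ q)%:E| = 0)%E.
  under eq_integral do rewrite gee0_abs ?lee_fin ?powR_ge0//.
  rewrite -[RHS]/((0 : R)%:E) -u0 fineK// ge0_fin_numE//.
  by apply: integral_ge0 => x _; rewrite lee_fin powR_ge0.
have mn := measurable_normc_powR q mu_.
have mE : measurable_fun setT (fun x => (Normc.normc (u x) `^ q)%:E).
  exact/measurable_EFinP.
have := (ae_eq_integral_abs mu measurableT mE).1 u0.
apply: filterS => x /= /(_ I)/= [] /powR_eq0_eq0 n0 _.
exact: Normc.eq0_normc.
Qed.

(** A product of bumps on []-1, 1[] works: if [Lpow] were 0 it would vanish a.e., yet it is nonzero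
    on a cube of measure [2 ^+ n]. *)
Lemma exists_H1_Lpow_gt0 (q : R) : 0 < q ->
  exists u, in_H1 u /\ 0 < Lpow q u.
Proof.
move=> q0; pose psi (i : 'I_n) := @bump R (-1) 1 1.
have suppsi i t : psi i t != 0 -> `[- 1, 1]%classic t.
  by rewrite bump_neq0 /= in_itv/= => /andP[/ltW-> /ltW->].
have tpsi : test_function (tensor psi).
  by apply: (@test_function_tensor _ _ _ 1) => // i; exact: smooth_bump.
exists (fun x => real_complex R (tensor psi x)); split; first exact: test_function_H1.
rewrite lt_def Lpow_ge0 andbT; apply/eqP => u0.
have mt := measurable_test_function tpsi.
have : ae_eq mu setT (fun x => real_complex R (tensor psi x)) (cst 0).
  apply: (@Lpow_eq0 q) => //; first by rewrite gt_eqF.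
    by apply: measurable_complex; [exact: mt|exact: measurable_cst].
  (* The integrand is at most the indicator of [box 1], since the bump is between 0 and 1 and
     vanishes outside. *)
  apply: le_lt_trans (@lebesgue_row_box_lty R n 1).
  rewrite -[leRHS]mul1e -integral_cst; last exact: measurable_box.
  rewrite [leRHS]integral_mkcond; apply: ge0_le_integral => //.
  - by move=> x _; rewrite lee_fin powR_ge0.
  - apply/measurable_EFinP; apply: measurable_normc_powR.
    by apply: measurable_complex; [exact: mt|exact: measurable_cst].
  - exact: (measurable_restrictT (cst 1%E) (@measurable_box R n 1)).1.
  - move=> x _; rewrite normc_real patchE; case: ifPn => xb.
      have t0 : 0 <= tensor psi x.
        by apply: prodr_ge0 => i _; have /andP[] := bump_itv (-1) 1 1 (x ord0 i).
      have q1 : 1 `^ q = 1 :> R by rewrite powR1.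
      rewrite lee_fin -[leRHS]q1 ge0_ler_powR ?nnegrE ?(ltW q0)// ger0_norm//.
      by apply: prodr_ile1 => i _; exact: bump_itv.
    have [->|tx] := eqVneq (tensor psi x) 0; first by rewrite normr0 powR0 ?gt_eqF.
    by move/negP: xb; rewrite inE; case; exact: (tensor_neq0_box suppsi tx).
move=> [N [mN N0 HN]].
pose O := @obox R n (fun=> -1) (fun=> 1); have : (mu O <= mu N)%E.
  apply: le_measure; rewrite ?inE//; first exact: measurable_obox.
  apply: subset_trans HN => x xo /= /(_ I) => -[] /eqP.
  apply/negP; rewrite /tensor; apply/prodf_neq0 => i _.
  by rewrite bump_neq0; have := xo i; rewrite /= in_itv.
rewrite N0 (@lebesgue_row_box R n (fun=> `]-1, 1[%classic)); last first.
  by move=> i; exact: measurable_itv.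
rewrite leNgt => /negP; apply.
rewrite (eq_bigr (fun=> 2%:E)); last first.
  move=> i _; rewrite lebesgue_measure_itv/= lte_fin ifT; last by lra.
  by rewrite -EFinB; congr (_%:E); lra.
by rewrite prodEFin lte_fin prodr_gt0.
Qed.

End TestFunctionsInH1.

(** * The variational argument in abstract form *)

Section ScalingVariational.
Context {R : realType} {T : Type}.
Variables (N p a b gamma : R).
(** [S s t] abstracts the passage from [W] to [expR s] times [W (expR t *: x)] in dimension [N].
    Exponential parameters make the group additive and all scaling conditions linear in [s] and
    [t]. *)
Variables (X : set T) (D M F : T -> R) (S : R -> R -> T -> T).
Hypotheses (p_gt1 : 1 < p) (N_gt0 : 0 < N) (a_def : a = N * (p - 1) / 2)
  (a_lt1 : a < 1) (b_def : b = p - a) (gamma_gt0 : 0 < gamma).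
Hypothesis XS : forall s t W, X W -> X (S s t W).
Hypothesis S0 : forall W, X W -> S 0 0 W = W.
Hypothesis SS : forall s t s' t' W, X W -> S s t (S s' t' W) = S (s + s') (t + t') W.
Hypothesis DS : forall s t W, X W -> D (S s t W) = expR (2 * s + (2 - N) * t) * D W.
Hypothesis MS : forall s t W, X W -> M (S s t W) = expR (2 * s - N * t) * M W.
Hypothesis FS : forall s t W, X W -> F (S s t W) = expR (2 * p * s - N * t) * F W.
Hypotheses (D_ge0 : forall W, X W -> 0 <= D W) (F_ge0 : forall W, X W -> 0 <= F W).
Hypothesis exF : exists V, [/\ X V, 0 < M V & 0 < F V].

(** Positivity of [M] encodes [W <> 0]; the equation is the vanishing of the derivative of the
    action at [W] in the direction [W]. *)
Definition nehari_set : set T := [set W | [/\ X W, 0 < M W & D W + M W = 2 * p * F W]].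

Definition nehari_minimizers : set T := [set W | nehari_set W /\
  forall V, nehari_set V ->
    2^-1 * D W - F W + 2^-1 * M W <= 2^-1 * D V - F V + 2^-1 * M V].

Definition sphere_minimizers : set T := [set W | [/\ X W, M W = gamma &
  forall V, X V -> M V = gamma -> 2^-1 * D W - F W <= 2^-1 * D V - F V]].

Let a_gt0 : 0 < a. Proof. by rewrite a_def divr_gt0// mulr_gt0// subr_gt0. Qed.
Let b_gt0 : 0 < b. Proof. by rewrite b_def; move: a_lt1 p_gt1; lra. Qed.
Let Na : N * (p - 1) = 2 * a. Proof. by rewrite a_def; field. Qed.

(** The logarithm of the Gagliardo-Nirenberg quotient [D^a M^b / F]. *)
Definition gn_quotient (W : T) : R := a * ln (D W) + b * ln (M W) - ln (F W).

(* [0 < D V] keeps the junk value [ln 0 = 0] out of the quotient. *)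
Definition gn_optimal (W : T) : Prop := [/\ X W, 0 < M W, 0 < F W, D W = 2 * a * F W &
  forall V, X V -> 0 < M V -> 0 < F V -> 0 < D V /\ gn_quotient W <= gn_quotient V].

Let lnZ (u x : R) : 0 < x -> ln (expR u * x) = u + ln x.
Proof. by move=> x0; rewrite lnM ?posrE ?expR_gt0// expRK. Qed.

(** The coefficient of [s] is [2a + 2b - 2p = 0], that of [t] is
    [2a - N (a + b) + N = 2a - N (p - 1) = 0]. *)
Let quotientS s t W : X W -> 0 < D W -> 0 < M W -> 0 < F W ->
  gn_quotient (S s t W) = gn_quotient W.
Proof.
move=> XW D0 M0 F0; rewrite /gn_quotient DS// MS// FS// !lnZ// b_def.
move: (ln (D W)) (ln (M W)) (ln (F W)) => x y z.
by have := Na; nra.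
Qed.

Let ln_le (x : R) : 0 < x -> ln x <= x - 1 /\ (ln x = x - 1 -> x = 1).
Proof.
move=> x0; have [x1|x1] := eqVneq x 1.
  by rewrite x1 ln1 subrr.
have lx : ln x != 0 by rewrite ln_eq0.
by have := expR_gt1Dx lx; rewrite lnK ?posrE// => h; split; lra.
Qed.

(** Bernoulli's inequality [x^a <= a x + 1 - a] at [x = expR z]. After division by [expR (a * z)],
    apply [1 + u < expR u] at [u = (1 - a) z] and [u = - a z] with weights [a] and [1 - a]: the
    linear terms cancel. *)
Let bernoulli (z : R) : expR (a * z) <= a * expR z + (1 - a) /\
  (expR (a * z) = a * expR z + (1 - a) -> z = 0).
Proof.
have E1 : expR z = expR (a * z) * expR ((1 - a) * z) by rewrite -expRD; congr expR; ring.
have E2 : 1 = expR (a * z) * expR (- (a * z)) by rewrite -expRD subrr expR0.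
have [->|z0] := eqVneq z 0; first by rewrite mulr0 expR0; split => //; lra.
have h1 := @expR_gt1Dx _ ((1 - a) * z) ltac:(by rewrite mulf_neq0// subr_eq0 gt_eqF).
have h2 := @expR_gt1Dx _ (- (a * z)) ltac:(by rewrite oppr_eq0 mulf_neq0// gt_eqF).
have e0 := expR_gt0 (a * z).
suff h : expR (a * z) < a * expR z + (1 - a) by split; [exact: ltW|move=> h'; lra].
have -> : a * expR z + (1 - a) =
  expR (a * z) * (a * expR ((1 - a) * z) + (1 - a) * expR (- (a * z))).
  by rewrite mulrDr !(mulrCA (expR (a * z))) -E1 -E2 mulr1.
rewrite ltr_pMr//.
have a1 : 0 < 1 - a by rewrite subr_gt0.
rewrite -subr_gt0 in h1; rewrite -subr_gt0 in h2.
by have := mulr_gt0 a_gt0 h1; have := mulr_gt0 a1 h2; lra.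
Qed.

(** Hence minimizing the action on the Nehari set amounts to minimizing [F] there. *)
Let nehari_F W : nehari_set W -> 0 < F W /\
  2^-1 * D W - F W + 2^-1 * M W = (p - 1) * F W.
Proof.
move=> [XW M0 DM]; split; last by lra.
have := D_ge0 XW; have : 0 < 2 * p * F W by rewrite -DM ltr_wpDl// D_ge0.
by rewrite pmulr_rgt0//; move: p_gt1; lra.
Qed.

Let to_nehari V : X V -> 0 < D V -> 0 < M V -> 0 < F V -> exists s t,
  [/\ D (S s t V) = 2 * a * F (S s t V), M (S s t V) = 2 * b * F (S s t V),
      0 < F (S s t V) & nehari_set (S s t V)].
Proof.
move=> XV D0 M0 F0.
(* In logarithms, [D = 2aF] and [M = 2bF] are two linear equations for [s] and [t], solved here.
   Both together imply the Nehari equation because [a + b = p]. *)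
pose s := (ln (2 * b) + ln (F V) - ln (M V)) / (2 * (1 - p)).
pose t := (ln (2 * a) - ln (2 * b) - ln (D V) + ln (M V)) / 2.
have p1 : 1 - p != 0 by rewrite subr_eq0 lt_eqF.
have eD : D (S s t V) = 2 * a * F (S s t V).
  rewrite DS// FS// -[D V in LHS]lnK// -[F V in RHS]lnK//.
  rewrite -[2 * a]lnK ?posrE ?mulr_gt0// -!expRD; congr expR.
  by rewrite /s /t; field.
have eM : M (S s t V) = 2 * b * F (S s t V).
  rewrite MS// FS// -[M V in LHS]lnK// -[F V in RHS]lnK//.
  rewrite -[2 * b in RHS]lnK ?posrE ?mulr_gt0// -!expRD; congr expR.
  by rewrite /s /t; field.
exists s, t; split => //; first by rewrite FS// mulr_gt0// expR_gt0.
split; [exact: XS|by rewrite MS// mulr_gt0// expR_gt0|].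
by rewrite eD eM b_def; ring.
Qed.

Let quotient_nehari W : 0 < F W -> D W = 2 * a * F W -> M W = 2 * b * F W ->
  gn_quotient W = a * ln (2 * a) + b * ln (2 * b) + (p - 1) * ln (F W).
Proof.
move=> F0 eD eM; rewrite /gn_quotient eD eM !lnM ?posrE ?mulr_gt0//.
by rewrite b_def; ring.
Qed.

(** Weighted AM-GM: with [x = D / (2aF)] and [y = M / (2bF)] the Nehari equation reads
    [a x + b y = a + b], so [a ln x + b ln y <= a (x - 1) + b (y - 1) = 0], and equality forces
    [x = 1]. *)
Let quotient_nehari_le W : nehari_set W -> 0 < D W ->
  gn_quotient W <= a * ln (2 * a) + b * ln (2 * b) + (p - 1) * ln (F W) /\
  (gn_quotient W = a * ln (2 * a) + b * ln (2 * b) + (p - 1) * ln (F W) ->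
    D W = 2 * a * F W).
Proof.
move=> nW D0; have [F0 _] := nehari_F nW; case: nW => _ M0 DM.
pose x := D W / (2 * a * F W); pose y := M W / (2 * b * F W).
have x0 : 0 < x by rewrite divr_gt0 ?mulr_gt0.
have y0 : 0 < y by rewrite divr_gt0 ?mulr_gt0.
have xy : a * x + b * y = p.
  have -> : p = (D W + M W) / (2 * F W) by rewrite DM; field; rewrite gt_eqF.
  by rewrite /x /y; field; rewrite !gt_eqF.
have -> : gn_quotient W = a * ln (2 * a) + b * ln (2 * b) + (p - 1) * ln (F W)
    + (a * ln x + b * ln y).
  rewrite /gn_quotient !ln_div ?posrE ?mulr_gt0// !lnM ?posrE ?mulr_gt0//.
  by rewrite b_def; ring.
have [lx lx1] := ln_le x0; have [ly _] := ln_le y0.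
have ax : a * ln x <= a * (x - 1) by rewrite ler_pM2l.
have bx : b * ln y <= b * (y - 1) by rewrite ler_pM2l.
split; first by move: b_def xy ax bx; lra.
move=> e; have /eqP : a * (ln x - (x - 1)) = 0 by move: b_def xy ax bx e; lra.
rewrite mulf_eq0 gt_eqF//= subr_eq0 => /eqP/lx1 x1.
by rewrite -[LHS](@divfK _ (2 * a * F W)) ?gt_eqF ?mulr_gt0// -/x x1 mul1r.
Qed.

Lemma nehari_minimizersP W : nehari_minimizers W <-> gn_optimal W /\ M W = 2 * b * F W.
Proof.
split.
- move=> [nW minW]; have [FW0 aW] := nehari_F nW; have [XW MW0 DMW] := nW.
  have minF V : nehari_set V -> F W <= F V.
    move=> nV; have := minW V nV; have [_ ->] := nehari_F nV; rewrite aW.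
    by rewrite ler_pM2l// subr_gt0.
  have Dpos V : X V -> 0 < M V -> 0 < F V -> 0 < D V.
    move=> XV M0 F0; rewrite lt_def D_ge0// andbT; apply/negP => /eqP D0.
    (* If [D V = 0], the Nehari equation determines [s] only. The free parameter [t] is set so that
       [ln (F (S s t V)) = ln (F W) - 1], against minimality. *)
    pose s := (ln (2 * p) + ln (F V) - ln (M V)) / (2 * (1 - p)).
    pose t := (2 * p * s + ln (F V) - ln (F W) + 1) / N.
    have p1 : 1 - p != 0 by rewrite subr_eq0 lt_eqF.
    have N0 : N != 0 by rewrite gt_eqF.
    have p0 : 0 < p by move: p_gt1; lra.
    have nS : nehari_set (S s t V).
      split; [exact: XS|by rewrite MS// mulr_gt0// expR_gt0|].
      rewrite DS// D0 mulr0 add0r MS// FS// -[M V in LHS]lnK// -[F V in RHS]lnK//.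
      transitivity (expR (ln (2 * p)) * (expR (2 * p * s - N * t) * expR (ln (F V)))).
        by rewrite -!expRD; congr expR; rewrite /s; field.
      by rewrite lnK ?posrE ?mulr_gt0.
    have := minF _ nS; rewrite leNgt => /negP; apply.
    rewrite FS// -[F V]lnK// -expRD -[ltRHS]lnK// ltr_expR.
    have tN : N * t = 2 * p * s + ln (F V) - ln (F W) + 1 by rewrite /t mulrC divfK.
    by lra.
  have DW0 := Dpos W XW MW0 FW0.
  have [le1 eq1] := quotient_nehari_le nW DW0.
  have optF V : X V -> 0 < M V -> 0 < F V ->
      a * ln (2 * a) + b * ln (2 * b) + (p - 1) * ln (F W) <= gn_quotient V.
    move=> XV M0 F0; have D0 := Dpos V XV M0 F0.
    have [s [t [eD eM Fs nS]]] := to_nehari XV D0 M0 F0.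
    rewrite -(quotientS s t)// (quotient_nehari Fs eD eM) lerD2l.
    by rewrite ler_pM2l ?subr_gt0// ler_ln ?posrE// minF.
  (* Taking [W] itself as competitor in [optF] turns the AM-GM bound into an equality, whence
     [D W = 2 * a * F W]. *)
  have eW : gn_quotient W = a * ln (2 * a) + b * ln (2 * b) + (p - 1) * ln (F W).
    by apply/eqP; rewrite eq_le le1 optF.
  have eD := eq1 eW; split; last by rewrite b_def; move: DMW; rewrite eD; lra.
  by split => // V XV M0 F0; split; [exact: Dpos|rewrite eW; exact: optF].
- move=> [[XW MW0 FW0 eD optW] eM].
  have nW : nehari_set W by split => //; rewrite eD eM b_def; ring.
  split => // V nV; have [FV0 ->] := nehari_F nV; have [_ ->] := nehari_F nW.
  rewrite ler_pM2l ?subr_gt0//; have [XV M0 _] := nV.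
  have [D0] := optW V XV M0 FV0; rewrite (quotient_nehari FW0 eD eM) => h.
  have [le1 _] := quotient_nehari_le nV D0.
  by have := le_trans h le1; rewrite lerD2l ler_pM2l ?subr_gt0// ler_ln ?posrE.
Qed.

Let quotient_sphere W : 0 < F W -> D W = 2 * a * F W -> M W = gamma ->
  gn_quotient W = a * ln (2 * a) + b * ln gamma + (a - 1) * ln (F W).
Proof.
move=> F0 eD eM; rewrite /gn_quotient eD eM !lnM ?posrE ?mulr_gt0//.
by ring.
Qed.

(** On the orbit of [V] under mass-preserving dilations, the energy is least where [D = 2aF].
    Relative to that point the energy excess is [F V'] times the gap in Bernoulli's inequality at
    [z = - (2 * t)]. *)
Let sphere_energy V : X V -> 0 < D V -> M V = gamma -> 0 < F V -> exists V',
  [/\ X V', 0 < F V', D V' = 2 * a * F V', M V' = gamma & [/\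
    gn_quotient V' = gn_quotient V,
    2^-1 * D V' - F V' <= 2^-1 * D V - F V &
    2^-1 * D V' - F V' = 2^-1 * D V - F V -> D V = 2 * a * F V]].
Proof.
move=> XV D0 eM F0; have M0 : 0 < M V by rewrite eM.
(* With [s = N t / 2] the mass is fixed, [D] gains [expR (2 * t)] and [F] gains [expR (2 * a * t)];
   this [t] solves [D = 2aF]. *)
pose t := (ln (2 * a) + ln (F V) - ln (D V)) / (2 * (1 - a)).
pose s := N * t / 2.
have a1 : 1 - a != 0 by rewrite subr_eq0 gt_eqF.
have sN : 2 * s - N * t = 0 by rewrite /s; field.
have sD : 2 * s + (2 - N) * t = 2 * t by move: sN; lra.
have sF : 2 * p * s - N * t = 2 * a * t.
  by rewrite -Na /s; field.
have F0' : 0 < F (S s t V) by rewrite FS// mulr_gt0// expR_gt0.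
have eD : D (S s t V) = 2 * a * F (S s t V).
  rewrite DS// FS// sD sF -[D V in LHS]lnK// -[F V in RHS]lnK//.
  transitivity (expR (ln (2 * a)) * (expR (2 * a * t) * expR (ln (F V)))).
    by rewrite -!expRD; congr expR; rewrite /t; field.
  by rewrite lnK ?posrE ?mulr_gt0.
have eM' : M (S s t V) = gamma by rewrite MS// sN expR0 mul1r.
exists (S s t V); split => //; first exact: XS.
have [le1 eq1] := bernoulli (- (2 * t)).
have FE : F V = expR (a * - (2 * t)) * F (S s t V).
  by rewrite FS// sF mulrA -expRD (_ : _ + _ = 0) ?expR0 ?mul1r//; ring.
have DE : D V = expR (- (2 * t)) * D (S s t V).
  by rewrite DS// sD mulrA -expRD (_ : _ + _ = 0) ?expR0 ?mul1r//; ring.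
have E : 2^-1 * D V - F V - (2^-1 * D (S s t V) - F (S s t V)) =
    F (S s t V) * (a * expR (- (2 * t)) + (1 - a) - expR (a * - (2 * t))).
  by rewrite [in LHS]DE [in LHS]FE eD; field.
split; first exact: quotientS.
- by rewrite -subr_ge0 E mulr_ge0 ?(ltW F0')// subr_ge0.
- move/eqP; rewrite eq_sym -subr_eq0 E mulf_eq0 (gt_eqF F0')/= subr_eq0 => /eqP/esym/eq1.
  move/eqP; rewrite oppr_eq0 mulf_eq0 pnatr_eq0/= => /eqP t0.
  by rewrite DE FE eD t0 mulr0 oppr0 mulr0 expR0 !mul1r.
Qed.

Let energy_optimal V : D V = 2 * a * F V -> 2^-1 * D V - F V = (a - 1) * F V.
Proof. by move=> ->; field. Qed.

(** Prescribing the mass leaves one free parameter, used to push [F] above [B]. For [D V = 0] this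
    makes the energy unbounded below on the sphere. *)
Let onto_sphere V : X V -> 0 < M V -> 0 < F V -> forall B, exists V',
  [/\ X V', M V' = gamma, 0 < F V', D V = 0 -> D V' = 0 /\ B < F V' &
    0 < D V -> gn_quotient V' = gn_quotient V /\ 0 < D V'].
Proof.
move=> XV M0 F0 B.
pose t := (ln (`|B| + 1) - p * (ln gamma - ln (M V)) - ln (F V) + 1) / (2 * a).
pose s := (N * t + ln gamma - ln (M V)) / 2.
have a0 : a != 0 by rewrite gt_eqF.
have sM : 2 * s - N * t = ln gamma - ln (M V) by rewrite /s; field.
exists (S s t V); split.
- exact: XS.
- by rewrite MS// sM -[M V in X in _ * X]lnK// -expRD subrK lnK.
- by rewrite FS// mulr_gt0// expR_gt0.
- move=> D0; rewrite DS// D0 mulr0; split => //.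
  have B0 : 0 < `|B| + 1 by rewrite ltr_wpDl.
  apply: (@lt_trans _ _ (`|B| + 1)); first by rewrite (le_lt_trans (ler_norm B))// ltrDl.
  rewrite FS// -[F V]lnK// -expRD -[ltLHS]lnK// ltr_expR.
  have -> : 2 * p * s - N * t = 2 * a * t + p * (ln gamma - ln (M V)).
    by rewrite -Na /s; field.
  have -> : 2 * a * t = ln (`|B| + 1) - p * (ln gamma - ln (M V)) - ln (F V) + 1.
    by rewrite /t; field.
  by lra.
- by move=> D0; split; [exact: quotientS|rewrite DS// mulr_gt0// expR_gt0].
Qed.

Lemma sphere_minimizersP W : sphere_minimizers W <-> gn_optimal W /\ M W = gamma.
Proof.
split.
- move=> [XW eM minW].
  have MW0 : 0 < M W by rewrite eM.
  have Dpos V : X V -> 0 < M V -> 0 < F V -> 0 < D V.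
    move=> XV M0 F0; rewrite lt_def D_ge0// andbT; apply/negP => /eqP D0.
    (* The bound is minus the energy of [W], so [V'], whose energy is [- F V'], would lie strictly
       below [W]. *)
    have [V' [XV' eM' F0' /(_ D0)[D0' BF] _]] :=
      onto_sphere XV M0 F0 (F W - 2^-1 * D W).
    by have := minW V' XV' eM'; rewrite D0'; lra.
  (* [exF] yields a competitor of negative energy [(a - 1) * F V2], whereas [F W <= 0] would make
     the energy of [W] nonnegative. *)
  have FW0 : 0 < F W.
    have [V [XV M0 F0]] := exF; have D0 := Dpos V XV M0 F0.
    have [V' [XV' eM' F0' _ /(_ D0)[_ D0']]] := onto_sphere XV M0 F0 0.
    have [V2 [XV2 F2 eD2 eM2 _]] := sphere_energy XV' D0' eM' F0'.
    have := minW V2 XV2 eM2; rewrite (energy_optimal eD2).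
    have : 0 < (1 - a) * F V2 by rewrite mulr_gt0// subr_gt0.
    by have := D_ge0 XW; lra.
  have DW0 := Dpos W XW MW0 FW0.
  have [W' [XW' FW' eDW' eMW' [_ leW eqW]]] := sphere_energy XW DW0 eM FW0.
  have eD : D W = 2 * a * F W by apply: eqW; apply/eqP; rewrite eq_le leW minW.
  split=> //; split=> // V XV M0 F0; have D0 := Dpos V XV M0 F0; split => //.
  have [V' [XV' eM' F0' _ /(_ D0)[qV' D0']]] := onto_sphere XV M0 F0 0.
  have [V2 [XV2 F2 eD2 eM2 [qV2 _ _]]] := sphere_energy XV' D0' eM' F0'.
  (* At points with [D = 2aF] and mass [gamma], quotient and energy both decrease as [F] grows,
     through the same factor [a - 1 < 0]. *)
  rewrite -qV' -qV2 (quotient_sphere FW0 eD eM) (quotient_sphere F2 eD2 eM2).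
  rewrite lerD2l ler_nM2l ?subr_lt0// ler_ln ?posrE//.
  have := minW V2 XV2 eM2; rewrite (energy_optimal eD) (energy_optimal eD2).
  by rewrite ler_nM2l ?subr_lt0.
- move=> [[XW MW0 FW0 eD optW] eM]; split => // V XV eMV.
  have MV0 : 0 < M V by rewrite eMV.
  have aF : 0 < (1 - a) * F W by rewrite mulr_gt0// subr_gt0.
  rewrite (energy_optimal eD); have [F0|F0] := ltP 0 (F V); last first.
    have -> : F V = 0 by apply/eqP; rewrite eq_le F0 F_ge0.
    by have := D_ge0 XV; lra.
  have [D0 _] := optW V XV MV0 F0.
  have [V2 [XV2 F2 eD2 eM2 [qV2 leV _]]] := sphere_energy XV D0 eMV F0.
  apply: le_trans leV; rewrite (energy_optimal eD2) ler_nM2l ?subr_lt0//.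
  have MV2 : 0 < M V2 by rewrite eM2.
  have [_] := optW V2 XV2 MV2 F2.
  rewrite (quotient_sphere FW0 eD eM) (quotient_sphere F2 eD2 eM2).
  by rewrite lerD2l ler_nM2l ?subr_lt0// ler_ln ?posrE.
Qed.

(* The one-parameter group along which [D] and [F] scale alike. *)
Let U s W := S s ((p - 1) * s) W.

Let D_U s W : X W -> D (U s W) = expR ((2 * p - 2 * a) * s) * D W.
Proof. by move=> XW; rewrite /U DS//; congr (expR _ * _); rewrite -Na; ring. Qed.

Let F_U s W : X W -> F (U s W) = expR ((2 * p - 2 * a) * s) * F W.
Proof. by move=> XW; rewrite /U FS//; congr (expR _ * _); rewrite -Na; ring. Qed.

Let M_U s W : X W -> M (U s W) = expR ((2 - 2 * a) * s) * M W.
Proof. by move=> XW; rewrite /U MS//; congr (expR _ * _); rewrite -Na; ring. Qed.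

Let UU s t W : X W -> U s (U t W) = U (s + t) W.
Proof. by move=> XW; rewrite /U SS//; congr S; ring. Qed.

Let U0 W : X W -> U 0 W = W.
Proof. by move=> XW; rewrite /U mulr0 S0. Qed.

Let optimal_U s W : gn_optimal W -> gn_optimal (U s W).
Proof.
move=> [XW M0 F0 eD opt]; have D0 : 0 < D W by have [] := opt W XW M0 F0.
split; first exact: XS.
- by rewrite M_U// mulr_gt0// expR_gt0.
- by rewrite F_U// mulr_gt0// expR_gt0.
- by rewrite D_U// F_U// eD; ring.
- by move=> V XV MV FV; rewrite quotientS//; exact: opt.
Qed.

Lemma minimizers_bijection : exists f : T -> T,
  set_bij nehari_minimizers sphere_minimizers f.
Proof.
have a1 : 2 - 2 * a != 0 by move: a_lt1 => h; apply/eqP; lra.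
have p1 : 2 * p - 2 != 0 by move: p_gt1 => h; apply/eqP; lra.
(* The unique time at which the orbit of [W] under [U] reaches mass [gamma]. *)
pose sg W := (ln gamma - ln (M W)) / (2 - 2 * a).
have Usg s W : X W -> 0 < M W -> expR ((2 - 2 * a) * s) * M W = gamma -> s = sg W.
  by move=> XW M0 e; rewrite /sg -e lnZ//; field.
have sgM W : X W -> 0 < M W -> M (U (sg W) W) = gamma.
  move=> XW M0; rewrite M_U// -[M W in X in _ * X]lnK// -expRD.
  rewrite (_ : _ + _ = ln gamma) ?lnK//.
  by rewrite /sg; field.
exists (fun W => U (sg W) W); split.
- move=> W /nehari_minimizersP[oW _]; apply/sphere_minimizersP.
  by split; [exact: optimal_U|case: oW => XW M0 _ _ _; exact: sgM].
- move=> W V /set_mem/nehari_minimizersP[oW eW] /set_mem/nehari_minimizersP[oV eV] WV.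
  have [XW MW FW _ _] := oW; have [XV MV FV _ _] := oV.
  pose r := - sg V + sg W.
  have VE : V = U r W by rewrite -UU// WV UU// addNr U0.
  (* Injectivity: [W] and [V] lie on one orbit and both satisfy [M = 2bF], but [U r] multiplies
     [M / F] by [expR ((2 - 2 * p) * r)], so [r = 0]. *)
  have e : expR ((2 - 2 * a) * r) * (2 * b * F W) = expR ((2 * p - 2 * a) * r) * (2 * b * F W).
    by move: eV; rewrite VE M_U// F_U// eW => ->; ring.
  have := congr1 (@ln R) e; rewrite !lnZ ?mulr_gt0// => /addIr/eqP.
  rewrite -subr_eq0 -mulrBl mulf_eq0.
  rewrite (_ : _ - _ = - (2 * p - 2)) ?oppr_eq0 ?(negPf p1)/=; last by ring.
  by move=> /eqP r0; rewrite VE r0 U0.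
- move=> V /sphere_minimizersP[oV eV]; have [XV MV FV _ _] := oV.
  (* The time at which the orbit of [V] satisfies [M = 2bF]; flowing back for time [- r] restores
     mass [gamma]. *)
  pose r := (ln (M V) - ln (2 * b) - ln (F V)) / (2 * p - 2).
  have XU : X (U r V) by exact: XS.
  have MU : 0 < M (U r V) by rewrite M_U// mulr_gt0// expR_gt0.
  exists (U r V).
    apply/nehari_minimizersP; split; first exact: optimal_U.
    rewrite M_U// F_U// -[M V in LHS]lnK// -[F V in RHS]lnK//.
    rewrite -[2 * b in RHS]lnK ?posrE ?mulr_gt0// -!expRD; congr expR.
    by rewrite /r; field.
  have -> : sg (U r V) = - r.
    by apply/esym; apply: Usg => //; rewrite -M_U// UU// addNr U0.
  by rewrite UU// addNr U0.
Qed.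

End ScalingVariational.

(** * Classes modulo a.e. equality and the bijection *)

Section Classes.
Context {R : realType} {n : nat}.
Local Notation Rn := 'rV[R]_n.
Local Notation mu := (@lebesgue_row R n).
Local Notation cls := {mfun_ mu, Rn >-> R[i]}.
Implicit Types (u v : Rn -> R[i]) (w : cls).
Local Open Scope quotient_scope.

Lemma measurable_cls w : measurable_fun setT (w : Rn -> R[i]).
Proof. exact: measurable_funPT. Qed.

Definition mk_cls u (mu_ : measurable_fun setT u) : cls :=
  \pi_cls (mfun_Sub (mem_set mu_)).

Lemma mk_clsE u (mu_ : measurable_fun setT u) : ae_eq mu setT (mk_cls mu_) u.
Proof.
have /eqmodP/asboolP : repr (mk_cls mu_) = mfun_Sub (mem_set mu_) %[mod cls].
  by rewrite reprK.
exact.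
Qed.

Lemma cls_eq w w' : ae_eq mu setT (w : Rn -> R[i]) w' -> w = w'.
Proof.
by move=> h; rewrite -(reprK w) -(reprK w'); apply/eqmodP/asboolP.
Qed.

(** Dilations preserve null sets, by the change of variables for an indicator; this makes scaling
    well defined on classes. *)
Lemma ae_eq_dilate (m l : R) u v : 0 < l -> ae_eq mu setT u v ->
  ae_eq mu setT (dilate m l u) (dilate m l v).
Proof.
move=> l0 [N [mN N0 HN]].
exists ((fun x : Rn => l *: x) @^-1` N); split.
- by rewrite -[X in measurable X]setTI; exact: measurable_scale_row.
- have mi : measurable_fun setT (fun x => (\1_N x)%:E : \bar R).
    by apply/measurable_EFinP; exact: measurable_indic.
  have mP : measurable ((fun x : Rn => l *: x) @^-1` N).
    by rewrite -[X in measurable X]setTI; exact: measurable_scale_row.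
  have e := ge0_integral_dilate l0 mi (fun x => _).
  transitivity (\int[mu]_x (\1_((fun x : Rn => l *: x) @^-1` N) x)%:E)%E.
    by rewrite integral_indic// setIT.
  apply: etrans (e _) _; last by rewrite integral_indic// setIT N0 mule0.
  by move=> x; rewrite lee_fin.
- move=> x /= h; apply: HN => /= uv; apply: h => _.
  by rewrite /dilate uv.
Qed.

Definition cscale (m l : R) w : cls := mk_cls (measurable_dilate m l (measurable_cls w)).

Lemma cscaleE m l w : ae_eq mu setT (cscale m l w) (dilate m l w).
Proof. exact: mk_clsE. Qed.

Lemma cscaleM m l m' l' w : 0 < l ->
  cscale m l (cscale m' l' w) = cscale (m * m') (l * l') w.
Proof.
move=> l0; apply: cls_eq; apply: ae_eq_trans (cscaleE _ _ _) _.
apply: ae_eq_trans (ae_eq_dilate m l0 (cscaleE _ _ _)) _.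
apply: ae_eq_trans (ae_eq_sym (cscaleE _ _ _)).
by apply: aeW => x _; rewrite /dilate rmorphM/= mulrA scalerA mulrC [l' * l]mulrC mulrC.
Qed.

Lemma cscale1 w : cscale 1 1 w = w.
Proof.
apply: cls_eq; apply: ae_eq_trans (cscaleE _ _ _) _.
by apply: aeW => x _; rewrite /dilate scale1r rmorph1 mul1r.
Qed.

Lemma Lpow_cscale (q m l : R) w : 0 < m -> 0 < l ->
  Lpow q (cscale m l w) = m `^ q * l ^- n * Lpow q w.
Proof.
move=> m0 l0; have mw := measurable_cls w.
have e := Lpow_ae q (measurable_cls _) (measurable_dilate m l mw) (cscaleE m l w).
by rewrite e Lpow_dilate.
Qed.

Lemma measurable_mulC u v : measurable_fun setT u -> measurable_fun setT v ->
  measurable_fun setT (fun x => u x * v x).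
Proof.
move=> mf mg.
have mRf := measurableT_comp measurable_Re mf; have mIf := measurableT_comp measurable_Im mf.
have mRg := measurableT_comp measurable_Re mg; have mIg := measurableT_comp measurable_Im mg.
apply: measurable_complex.
- rewrite (_ : (fun x => _) = (fun x => complex.Re (u x) * complex.Re (v x) -
    complex.Im (u x) * complex.Im (v x))); last first.
    by apply/funext => x; case: (u x) (v x) => ? ? [].
  by apply: measurable_funB; exact: measurable_funM.
- rewrite (_ : (fun x => _) = (fun x => complex.Re (u x) * complex.Im (v x) +
    complex.Im (u x) * complex.Re (v x))); last first.
    by apply/funext => x; case: (u x) (v x) => ? ? [].
  by apply: measurable_funD; exact: measurable_funM.
Qed.

Lemma Lpow_cscale_mul (q m l : R) w w' : 0 < m -> 0 < l ->
  Lpow q (fun x => cscale m l w x * cscale m l w' x) =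
  m `^ (2 * q) * l ^- n * Lpow q (fun x => w x * w' x).
Proof.
move=> m0 l0; have mw := measurable_cls w; have mw' := measurable_cls w'.
have -> : m `^ (2 * q) = (m * m) `^ q.
  by rewrite powRrM -expr2 -powR_mulrn// ltW.
rewrite -Lpow_dilate ?mulr_gt0//; last exact: measurable_mulC.
apply: Lpow_ae.
- by apply: measurable_mulC; exact: measurable_cls.
- by apply: measurable_dilate; exact: measurable_mulC.
- apply: filterS2 (cscaleE m l w) (cscaleE m l w') => x /= h h' _.
  by rewrite (h I) (h' I) /dilate rmorphM/= mulrACA.
Qed.

Lemma in_H1_cscale (m l : R) w : 0 < m -> 0 < l -> in_H1 w ->
  in_H1 (cscale m l w) /\
  dirichlet (cscale m l w) = (m * l) ^+ 2 * l ^- n * dirichlet w.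
Proof.
move=> m0 l0 Hw; have [Hd <-] := in_H1_dilate m0 l0 Hw.
apply: in_H1_ae Hd; first exact: measurable_cls.
by apply: ae_eq_sym; exact: cscaleE.
Qed.

Lemma Lpow0 (q : R) : q != 0 -> Lpow q (cst 0 : Rn -> R[i]) = 0.
Proof.
move=> q0; rewrite /Lpow /Rintegral integral0_eq// => x _.
by rewrite Normc.normc0 powR0.
Qed.

Definition cls0 : cls := \pi_cls (cst (0 : R[i])).

Lemma cls0E : ae_eq mu setT cls0 (cst 0).
Proof.
have /eqmodP/asboolP : repr cls0 = cst 0 %[mod cls] by rewrite reprK.
exact.
Qed.

Lemma Lpow_cls0 (q : R) : q != 0 -> Lpow q cls0 = 0.
Proof.
by move=> q0; rewrite (Lpow_ae q (measurable_cls _) (measurable_cst _) cls0E) Lpow0.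
Qed.

Lemma Lpow2_cls_eq0 w : in_H1 w -> Lpow 2 w = 0 -> w = cls0.
Proof.
move=> [[mw iw] _] w0; apply: cls_eq; apply: ae_eq_trans (ae_eq_sym cls0E).
apply: (@Lpow_eq0 _ _ 2) => //.
by under eq_integral do rewrite powR_mulrn ?normc_ge0//.
Qed.

End Classes.

(** * The concrete functionals satisfy the abstract scaling hypotheses *)

Section Assembly.
Context {R : realType} {n : nat}.
Variables (p beta w1 w2 : R).
Hypotheses (n_ge1 : (1 <= n)%N) (p_gt1 : 1 < p) (p_lt : p < 1 + 2 / n%:R)
  (beta_gt0 : 0 < beta) (w1_gt0 : 0 < w1) (w2_gt0 : 0 < w2).
Local Notation Rn := 'rV[R]_n.
Local Notation mu := (@lebesgue_row R n).
Local Notation vclass := (@vclass R n).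
Implicit Types (W V : vclass).

Let D W := vdirichlet (vrepr W).
Let M W := vmass w1 w2 (vrepr W).
Let F W := potential p beta (vrepr W).

Definition vscale (s t : R) W : vclass :=
  (cscale (expR s) (expR t) W.1, cscale (expR s) (expR t) W.2).

Let expRX (x : R) : expR x ^+ n = expR (n%:R * x).
Proof. by rewrite mulrC expRM powR_mulrn ?expR_ge0. Qed.

Let expR_exponent (x s t : R) : expR s `^ x * expR t ^- n = expR (x * s - n%:R * t).
Proof. by rewrite expRX -expRN -expRM -expRD mulrC. Qed.

Let HH1_vscale s t W : HH1 W -> HH1 (vscale s t W).
Proof.
move=> [h1 h2]; split.
- by have [] := in_H1_cscale (expR_gt0 s) (expR_gt0 t) h1.
- by have [] := in_H1_cscale (expR_gt0 s) (expR_gt0 t) h2.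
Qed.

Let vscale0 W : vscale 0 0 W = W.
Proof. by case: W => u v; rewrite /vscale expR0 !cscale1. Qed.

Let vscaleD s t s' t' W : vscale s t (vscale s' t' W) = vscale (s + s') (t + t') W.
Proof. by rewrite /vscale !cscaleM ?expR_gt0// -!expRD. Qed.

Let D_vscale s t W : HH1 W -> D (vscale s t W) = expR (2 * s + (2 - n%:R) * t) * D W.
Proof.
move=> [h1 h2]; have [_ e1] := in_H1_cscale (expR_gt0 s) (expR_gt0 t) h1.
have [_ e2] := in_H1_cscale (expR_gt0 s) (expR_gt0 t) h2.
rewrite /D /vdirichlet [in LHS]/= e1 e2 -mulrDr; congr (_ * _).
rewrite -powR_mulrn ?mulr_ge0 ?expR_ge0// -expRD expR_exponent.
by congr expR; ring.
Qed.

Let M_vscale s t W : M (vscale s t W) = expR (2 * s - n%:R * t) * M W.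
Proof.
rewrite /M /vmass [in LHS]/= !Lpow_cscale ?expR_gt0// expR_exponent.
by rewrite mulrDr !(mulrCA _ (expR _)).
Qed.

Let F_vscale s t W : F (vscale s t W) = expR (2 * p * s - n%:R * t) * F W.
Proof.
rewrite /F /potential [in LHS]/= !Lpow_cscale ?expR_gt0// Lpow_cscale_mul ?expR_gt0//.
rewrite expR_exponent.
have E (c h k x y z : R) : h * (c * x + c * y + k * (c * z)) = c * (h * (x + y + k * z)).
  by ring.
exact: E.
Qed.

Let dirichlet_ge0 (u : Rn -> R[i]) : 0 <= dirichlet u.
Proof. by apply: sumr_ge0 => k _; exact: Lpow_ge0. Qed.

Let D_ge0 W : 0 <= D W.
Proof. by rewrite /D /vdirichlet addr_ge0. Qed.

Let p_gt0 : 0 < p. Proof. exact: lt_trans p_gt1. Qed.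

Let F_ge0 W : 0 <= F W.
Proof.
rewrite /F /potential mulr_ge0 ?invr_ge0 ?mulr_ge0 ?(ltW p_gt0)//.
by rewrite !addr_ge0 ?mulr_ge0 ?Lpow_ge0 ?(ltW beta_gt0).
Qed.

Let M_gt0P W : HH1 W -> (0 < M W) <-> W <> vclass0.
Proof.
move=> [h1 h2]; have W0 : vclass0 = (cls0, cls0) :> vclass by [].
have e2 : (2 : R) != 0 by [].
split=> [M0 WE|WE].
  move: M0; rewrite WE.
  have -> : M vclass0 = w1 * Lpow 2 (@cls0 R n) + w2 * Lpow 2 (@cls0 R n) by [].
  by rewrite !Lpow_cls0// !mulr0 addr0 ltxx.
have pos (x y : R) : 0 <= x -> 0 <= y -> ~ (x = 0 /\ y = 0) -> 0 < w1 * x + w2 * y.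
  move=> x0 y0 xy; have m1 : 0 <= w1 * x by rewrite mulr_ge0// ltW.
  have m2 : 0 <= w2 * y by rewrite mulr_ge0// ltW.
  rewrite lt_def addr_ge0// andbT paddr_eq0// !mulf_eq0 (gt_eqF w1_gt0) (gt_eqF w2_gt0)/=.
  by apply/negP => /andP[/eqP ? /eqP ?]; apply: xy.
apply: pos; [exact: Lpow_ge0|exact: Lpow_ge0|case=> l1 l2].
apply: WE; rewrite W0 -{1}(Lpow2_cls_eq0 h1 l1) -(Lpow2_cls_eq0 h2 l2).
by case: (W).
Qed.

(** For small [t] the line through [W] in its own direction consists of the multiples [(1 + t) W],
    on which the action is the explicit function [g]; differentiate [g] at 0. *)
Let dactionE W : HH1 W ->
  daction p beta w1 w2 (vrepr W) (vrepr W) = D W + M W - 2 * p * F W.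
Proof.
move=> [h1 h2]; have mw1 := measurable_cls W.1; have mw2 := measurable_cls W.2.
pose g (t : R) : R := 2^-1 * (1 + t) ^+ 2 * (D W + M W) - (1 + t) `^ (2 * p) * F W.
(* Nearness to 0 guarantees [0 < 1 + t], so that the scaling laws for [dilate (1 + t) 1] apply. *)
have ag : \forall t \near (0 : R), action p beta w1 w2 (Defs.vline (vrepr W) (vrepr W) t) = g t.
  near=> t.
  have t0 : 0 < 1 + t.
    by rewrite -ltrBlDl sub0r; near: t; apply: lt_nbhsr; rewrite oppr_lt0.
  have lineE (u : Rn -> R[i]) : (fun x => u x + real_complex R t * u x) = dilate (1 + t) 1 u.
    by apply/funext => x; rewrite /dilate scale1r rmorphD rmorph1 mulrDl mul1r.
  have [_ d1] := in_H1_dilate t0 ltr01 h1; have [_ d2] := in_H1_dilate t0 ltr01 h2.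
  have -> : Defs.vline (vrepr W) (vrepr W) t = (dilate (1 + t) 1 W.1, dilate (1 + t) 1 W.2).
    by rewrite /Defs.vline /= !lineE.
  rewrite /action /energy /vdirichlet /vmass /potential [in LHS]/= d1 d2.
  have -> : (fun x => dilate (1 + t) 1 W.1 x * dilate (1 + t) 1 W.2 x) =
      dilate ((1 + t) * (1 + t)) 1 (fun x => W.1 x * W.2 x).
    by apply/funext => x; rewrite /dilate scale1r rmorphM/= mulrACA.
  rewrite !Lpow_dilate ?mulr_gt0 ?ltr01//; last exact: measurable_mulC.
  have -> : ((1 + t) * (1 + t)) `^ p = (1 + t) `^ (2 * p).
    by rewrite powRrM powR_mulrn ?(ltW t0)// expr2.
  rewrite powR_mulrn ?(ltW t0)// expr1n invr1.
  have E (r q h d1' d2' x1 x2 k1 k2 k3 : R) :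
      2^-1 * ((r * 1) ^+ 2 * 1 * d1' + (r * 1) ^+ 2 * 1 * d2') -
      h * (q * 1 * k1 + q * 1 * k2 + 2 * beta * (q * 1 * k3)) +
      2^-1 * (w1 * (r ^+ 2 * 1 * x1) + w2 * (r ^+ 2 * 1 * x2)) =
      2^-1 * r ^+ 2 * (d1' + d2' + (w1 * x1 + w2 * x2)) -
      q * (h * (k1 + k2 + 2 * beta * k3)) by ring.
  exact: E.
rewrite /daction derive1E (near_eq_derive _ ag).
have dg : is_derive (0 : R) 1 g (D W + M W - 2 * p * F W).
  have d1 : is_derive (0 : R) 1 (fun t : R => 1 * t + 1) 1 := is_derive_affine 1 1 0.
  have d2 := is_deriveM d1 d1.
  have pos1 : 0 < (1 : R) * 0 + 1 by rewrite mulr0 add0r.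
  have d3 := @is_derive1_comp _ ((@powR R)^~ (2 * p)) (fun t : R => 1 * t + 1) 0 _ _
    (is_derive1_powR (2 * p) pos1) d1.
  have := is_deriveB (is_deriveZ (2^-1 * (D W + M W)) d2) (is_deriveZ (F W) d3).
  rewrite mulr0 add0r powR1 !mulr1.
  rewrite (_ : _ - _ = D W + M W - 2 * p * F W); last first.
    by rewrite /GRing.scale/=; field.
  congr is_derive; apply/funext => t.
  transitivity (2^-1 * (D W + M W) * ((1 * t + 1) * (1 * t + 1)) -
    F W * (1 * t + 1) `^ (2 * p)); first by [].
  by rewrite /g mul1r [t + 1]addrC; ring.
by have [_] := dg.
Unshelve. all: by end_near.
Qed.

Let inf_min (T : Type) (f : T -> R) (A : set T) x : A x ->
  (f x)%:E = ereal_inf [set (f y)%:E | y in A] <-> forall y, A y -> f x <= f y.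
Proof.
move=> Ax; split=> [e y Ay|h].
  by rewrite -lee_fin e; apply: ge_ereal_inf; exists (f y)%:E => //; exists y.
apply/eqP; rewrite eq_le; apply/andP; split.
  by apply/ereal_infP => _ [y Ay <-]; rewrite lee_fin h.
by apply: ge_ereal_inf; exists (f x)%:E => //; exists x.
Qed.

Let nehariE : nehari p beta w1 w2 = nehari_set p (@HH1 R n) D M F.
Proof.
apply/seteqP; split => W.
- move=> [XW W0 /eqP]; rewrite dactionE// subr_eq0 => /eqP e.
  by split => //; exact/M_gt0P.
- move=> [XW M0 e]; split => //; first exact/M_gt0P.
  by rewrite dactionE// e subrr.
Qed.

Let ground_statesE : ground_states n p beta w1 w2 = nehari_minimizers p (@HH1 R n) D M F.
Proof.
apply/seteqP; split => W.
- rewrite /ground_states /mkset /m_nehari nehariE => -[nW h]; split; first exact: nW.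
  by apply/(inf_min (fun W => action p beta w1 w2 (vrepr W)) nW).
- rewrite /ground_states /mkset /m_nehari nehariE => -[nW h]; split; first exact: nW.
  by apply/(inf_min (fun W => action p beta w1 w2 (vrepr W)) nW).
Qed.

Let energy_minimizersE gamma : energy_minimizers n p beta w1 w2 gamma =
  sphere_minimizers gamma (@HH1 R n) D M F.
Proof.
apply/seteqP; split => W.
- move=> [[XW MW] h]; split; [exact: XW|exact: MW|move=> V XV MV].
  have /(_ V (conj XV MV)) := (inf_min (fun W => energy p beta (vrepr W)) (conj XW MW)).1 h.
  exact.
- move=> [XW MW h]; split; first by split; [exact: XW|exact: MW].
  apply/(inf_min (fun W => energy p beta (vrepr W)) (conj XW MW)) => V [XV MV].
  exact: h.
Qed.

Let exists_F_gt0 : exists V, [/\ HH1 V, 0 < M V & 0 < F V].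
Proof.
have p2 : 0 < 2 * p by rewrite mulr_gt0.
have [u [Hu u0]] := @exists_H1_Lpow_gt0 R n _ p2.
have mu_ := measurable_L2 Hu.1; pose c := mk_cls mu_.
have mc := measurable_cls c.
have uc := ae_eq_sym (mk_clsE mu_).
have Lc : 0 < Lpow (2 * p) c by rewrite -(Lpow_ae _ mu_ mc uc).
have Hc : HH1 ((c, c) : vclass) by split; exact: (in_H1_ae mc uc Hu).1.
exists (c, c); split=> //.
- apply/M_gt0P => // -[cE _]; move: Lc.
  by rewrite cE [Lpow _ _]Lpow_cls0 ?ltxx// gt_eqF.
- rewrite /F /potential mulr_gt0 ?invr_gt0// ltr_wpDr ?addr_gt0//.
  by rewrite !mulr_ge0 ?Lpow_ge0 ?(ltW beta_gt0).
Qed.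

Lemma ground_states_bijection (gamma : R) : 0 < gamma ->
  exists f : vclass -> vclass,
    set_bij (ground_states n p beta w1 w2)
            (energy_minimizers n p beta w1 w2 gamma) f.
Proof.
move=> gamma_gt0; rewrite ground_statesE energy_minimizersE.
have n0 : 0 < n%:R :> R by rewrite ltr0n.
apply: (@minimizers_bijection R _ n%:R p (n%:R * (p - 1) / 2) (p - n%:R * (p - 1) / 2)
  gamma (@HH1 R n) D M F vscale) => //.
(* The goal left is [a < 1], which is the upper bound on [p]. *)
move: p_lt; rewrite -ltrBlDl ltr_pdivlMr// => h.
by rewrite ltr_pdivrMr// mul1r mulrC.
Qed.

End Assembly.

Unset Implicit Arguments.

Theorem corollary3p7 (R : realType) (n : nat) (p gamma beta w1 w2 : R)
    (n_ge1 : (1 <= n)%N) (p_gt1 : 1 < p) (p_lt : p < 1 + 2 / n%:R)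
    (gamma_gt0 : 0 < gamma) (beta_gt0 : 0 < beta)
    (w1_gt0 : 0 < w1) (w2_gt0 : 0 < w2) :
  exists f : vclass -> vclass,
    set_bij (ground_states n p beta w1 w2)
            (energy_minimizers n p beta w1 w2 gamma) f.
Proof. exact: ground_states_bijection. Qed.
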